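(* Let \[ \mathbb{P}_3=\det\begin{bmatrix} x_1 & x_1^2 & x_1^4\\ x_2 & x_2^2 & x_2^4\\ x_3 & x_3^2 & x_3^4\end{bmatrix}\in(\mathbb{Z}/2)[x_1,x_2,x_3] \] be the Dickson polynomial in three variables, and let $d\ge 1$ and $k\ge 0$ be integers. If \[ (x_2+x_3)\left(\frac{1}{x_1}\mathbb{P}_3\right)^k\notin (x_1^d,x_2^d,x_3^d), \] where the right-hand side is the ideal of $(\mathbb{Z}/2)[x_1,x_2,x_3]$ generated by $x_1^d,x_2^d,x_3^d$, then every mass distribution $\mu$ in $\mathbb{R}^d$ admits an equipartition by a collection of $2k$ parallel hyperplanes and two additional non-parallel hyperplanes in $(2k+1)\times 2\times 2$ boxes; that is, such hyperplanes exist for which each of the $4(2k+1)$ boxes has $\mu$-measure $\frac{1}{4(2k+1)}\mu(\mathbb{R}^d)$.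
   Context: A mass distribution in $\mathbb{R}^d$ is a finite Borel measure $\mu$ of the form $\mu(A)=\int_A f\,dx$ for an integrable density function $f:\mathbb{R}^d\to\mathbb{R}$ (integration with respect to Lebesgue measure), such that every nonempty open subset of $\mathbb{R}^d$ has positive $\mu$-measure. The two additional hyperplanes being non-parallel means that neither is parallel to the hyperplanes of the parallel collection and that they are not parallel to each other. Boxes: a collection of $l$ parallel hyperplanes divides $\mathbb{R}^d$ into $l+1$ consecutive regions, and each additional hyperplane divides $\mathbb{R}^d$ into two half-spaces; the $(l+1)\times 2\times 2$ boxes are the intersections of one of the $l+1$ regions with one half-space of each of the two additional hyperplanes. The polynomial $\mathbb{P}_3$ is divisible by $x_1$, and $\frac{1}{x_1}\mathbb{P}_3$ denotes the quotient polynomial. *)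

(* Defs.v *)
From HB Require Import structures.
From mathcomp Require Import all_boot all_order all_algebra.
From mathcomp Require Import all_classical all_reals all_analysis.
(* Notations of mpoly clash with those of mathcomp-analysis. *)
From mathcomp Require mpoly.
Import (canonicals, coercions) mpoly.

Set Implicit Arguments.
Unset Strict Implicit.
Unset Printing Implicit Defensive.

Import Order.TTheory GRing.Theory Num.Theory.
Import numFieldNormedType.Exports.

Local Open Scope classical_set_scope.
Local Open Scope ring_scope.

Definition in_ideal (A : comNzRingType) (n : nat) (g : 'I_n -> A) (p : A) : Prop :=
  exists c : 'I_n -> A, p = \sum_(i < n) c i * g i.

(* F_2[x_1, x_2, x_3]; the variables x_1, x_2, x_3 are xvar 0, xvar 1, xvar 2. *)
Definition F2x3 : idomainType := mpoly.mpoly 3 'F_2.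

Definition xvar (i : 'I_3) : F2x3 := mpoly.mpolyX 'F_2 (mpoly.mnm1 i).

Definition dickson3 : F2x3 := \det (\matrix_(i < 3, j < 3) xvar i ^+ (2 ^ j)).

Lemma dickson3_divisible : exists q : F2x3, q * xvar 0 == dickson3.
Proof.
exists (\det (\matrix_(i < 3, j < 3)
   (if i == 0 then xvar i ^+ (2 ^ j).-1 else xvar i ^+ (2 ^ j)))).
set M := \matrix_(i, j) _.
apply/eqP; rewrite /dickson3 mulrC.
rewrite [RHS](determinant_multilinear (i0 := 0) (B := M) (C := M) (b := xvar 0) (c := 0)).
- by rewrite mul0r addr0.
- apply/rowP => j; rewrite scale0r addr0 !mxE /= -exprS.
  by rewrite prednK// expn_gt0.
- by apply/matrixP => i j; rewrite !mxE/=.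
- by apply/matrixP => i j; rewrite !mxE/=.
Qed.

(* P_3 / x_1; the quotient is unique since F2x3 is a domain. *)
Definition dickson3_quot : F2x3 := xchoose dickson3_divisible.

Lemma dickson3_quotP : dickson3_quot * xvar 0 = dickson3.
Proof. exact/eqP/(xchooseP dickson3_divisible). Qed.

Section tcons_measure.
Context d (T : measurableType d) (R : realType) (n : nat).
Variables (l : {sigma_finite_measure set T -> \bar R})
  (m : {sigma_finite_measure set (n.-tuple T) -> \bar R}).
Local Open Scope ereal_scope.

Let tcons (p : T * n.-tuple T) : n.+1.-tuple T := [tuple of p.1 :: p.2].

Let measurable_tcons : measurable_fun [set: T * n.-tuple T] tcons.
Proof. exact: measurable_cons. Qed.

(* The product measure l \x m, carried by T^(n+1) instead of T * T^n. *)
Definition tcons_measure : set (n.+1.-tuple T) -> \bar R :=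
  pushforward (l \x m) tcons.

Let tcons0 : tcons_measure set0 = 0.
Proof. by rewrite /tcons_measure /pushforward preimage_set0 measure0. Qed.

Let tcons_ge0 A : 0 <= tcons_measure A.
Proof. by rewrite /tcons_measure /pushforward; exact: measure_ge0. Qed.

Let tcons_sigma_additive : semi_sigma_additive tcons_measure.
Proof.
move=> F mF tF mUF; rewrite /tcons_measure /pushforward preimage_bigcup.
apply: measure_semi_sigma_additive.
- by move=> i; rewrite -[X in measurable X]setTI; exact: measurable_tcons.
- apply/trivIsetP => /= i j _ _ ij; rewrite -preimage_setI.
  by move/trivIsetP : tF => /(_ _ _ _ _ ij) ->//; rewrite preimage_set0.
- by rewrite -preimage_bigcup -[X in measurable X]setTI; exact: measurable_tcons.
Qed.

HB.instance Definition _ := isMeasure.Build _ _ _ tcons_measure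
  tcons0 tcons_ge0 tcons_sigma_additive.

Let tcons_sigma_finite : sigma_finite setT tcons_measure.
Proof.
have /sigma_finiteP[F [FT ndF Foo]] := sigma_finiteT l.
have /sigma_finiteP[G [GT ndG Goo]] := sigma_finiteT m.
pose g (t : n.+1.-tuple T) : T * n.-tuple T := (thead t, [tuple of behead t]).
have mg : measurable_fun setT g.
  apply/measurable_fun_pairP; split => //=.
  - exact: measurable_tnth.
  - exact: measurable_behead.
exists (fun i => g @^-1` (F i `*` G i)).
  apply/seteqP; split => // t _.
  have [i _ Fi] : (\bigcup_i F i) (thead t) by rewrite -FT.
  have [j _ Gj] : (\bigcup_i G i) [tuple of behead t] by rewrite -GT.
  exists (maxn i j) => //; split => /=.
  - by move: Fi; exact/subsetPset/ndF/leq_maxl.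
  - by move: Gj; exact/subsetPset/ndG/leq_maxr.
move=> i; have [mF Fi] := Foo i; have [mG Gi] := Goo i; split.
  by rewrite -[X in measurable X]setTI; apply: mg => //; exact: measurableX.
rewrite /tcons_measure /pushforward -comp_preimage.
rewrite (_ : g \o _ = id); last first.
  by apply/funext => -[x t] /=; congr pair; exact: val_inj.
by rewrite preimage_id product_measure1E// lte_mul_pinfty// ge0_fin_numE.
Qed.

HB.instance Definition _ := Measure_isSigmaFinite.Build _ _ _ tcons_measure
  tcons_sigma_finite.
End tcons_measure.

Section lebesgue_tuple.
Variable R : realType.
Local Open Scope ereal_scope.

Fixpoint lebesgue_tuple (n : nat) :
    {sigma_finite_measure set (n.-tuple (measurableTypeR R)) -> \bar R} :=
  match n with
  | 0 => [the {sigma_finite_measure set _ -> \bar R} of \d_([tuple] : 0.-tuple (measurableTypeR R))]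
  | n.+1 => tcons_measure (@lebesgue_measure R) (lebesgue_tuple n)
  end.

Lemma lebesgue_tuple_box n (a b : n.-tuple R) :
  (forall i, (tnth a i <= tnth b i)%R) ->
  lebesgue_tuple n [set t | forall i, (tnth a i <= tnth t i <= tnth b i)%R] =
  (\prod_(i < n) (tnth b i - tnth a i))%:E.
Proof.
elim: n a b => [|n IH] a b ab /=.
  by rewrite big_ord0 diracE mem_set//= => -[].
case/tupleP: a ab => a0 a ab; case/tupleP: b ab => b0 b ab.
rewrite /tcons_measure /pushforward.
rewrite (_ : _ @^-1` _ = `[a0, b0] `*`
    [set t | forall i, (tnth a i <= tnth t i <= tnth b i)%R]); last first.
  apply/seteqP; split => [[x t] /= H|[x t] [/= H0 H] i].
    split; first by have := H ord0; rewrite !tnth0 in_itv.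
    by move=> i; have := H (lift ord0 i); rewrite !tnthS.
  case: (unliftP ord0 i) => [j|] ->; first by rewrite !tnthS.
  by rewrite !tnth0; move: H0; rewrite in_itv.
rewrite product_measure1E//; last first.
  rewrite (_ : mkset _ =
    \bigcap_(i in [set: 'I_n]) ((@tnth n R)^~ i @^-1` `[tnth a i, tnth b i])).
    apply: fin_bigcap_measurable => // i _.
    by rewrite -[X in measurable X]setTI; exact: measurable_tnth.
  apply/seteqP; split => t /= H i.
    by move=> _ /=; rewrite in_itv/=; exact: H.
  by have := H i I; rewrite /= in_itv.
rewrite IH; last by move=> i; have := ab (lift ord0 i); rewrite !tnthS.
rewrite big_ord_recl !tnth0 EFinM; congr (_ * _).
  rewrite [LHS](lebesgue_measure_itv `[a0, b0]) /= lte_fin.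
  have := ab ord0; rewrite !tnth0 le_eqVlt => /predU1P[->|->//].
  by rewrite ltxx subrr.
by congr EFin; apply: eq_bigr => i _; rewrite !tnthS.
Qed.

End lebesgue_tuple.

(* R^d with its Borel sigma-algebra; 'rV[R]_d has no measurable structure. *)
Definition euclid (R : realType) (d : nat) : Type :=
  g_sigma_algebraType (@open 'rV[R]_d).
HB.instance Definition _ (R : realType) (d : nat) :=
  Measurable.copy (euclid R d) (g_sigma_algebraType (@open 'rV[R]_d)).

Section lebesgue_euclid.
Variables (R : realType) (d : nat).
Local Open Scope ereal_scope.

Let vec (t : d.-tuple (measurableTypeR R)) : euclid R d := \row_i tnth t i.

Let box (p : d.-tuple rat * nat) : set 'rV[R]_d :=
  [set v | forall i, (ratr (tnth p.1 i) < v ord0 i < ratr (tnth p.1 i) + p.2.+1%:R^-1)%R].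

Let open_box (U : set 'rV[R]_d) (v : 'rV[R]_d) : open U -> U v ->
  exists2 p, box p v & box p `<=` U.
Proof.
rewrite openE => /[apply] /nbhs_ballP[e /= e0 eU].
pose m := Num.truncn e^-1.
have me : (m.+1%:R^-1 < e)%R.
  by rewrite -[ltRHS]invrK ltf_pV2 ?posrE ?invr_gt0// truncnS_gt.
have q_ex i : {q : rat | (v ord0 i - m.+1%:R^-1 < ratr q < v ord0 i)%R}.
  apply: cid; have [|q] := @rat_in_itvoo R (v ord0 i - m.+1%:R^-1)%R (v ord0 i).
    by rewrite ltrBlDr ltrDl invr_gt0.
  by rewrite in_itv/= => qv; exists q.
exists ([tuple sval (q_ex i) | i < d], m).
  move=> i /=; rewrite tnth_mktuple; case: (q_ex i) => q /= /andP[vq ->/=].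
  by rewrite -ltrBlDr.
move=> w /= bw; apply: eU; split => // i j; rewrite (_ : i = ord0); last exact: ord1.
have := bw j; rewrite tnth_mktuple; case: (q_ex j) => q /= /andP[vq qv] /andP[qw wq].
rewrite /ball/= ltr_distl ltrBlDr; apply/andP; split.
- by rewrite (lt_trans wq)// ltrD.
- by rewrite (lt_trans (_ : _ < ratr q + m.+1%:R^-1)%R) ?ltrD// -ltrBlDr.
Qed.

Let measurable_vec : measurable_fun setT vec.
Proof.
have mvec := @measurability _ _ _ (euclid R d) setT vec (@open 'rV[R]_d) erefl.
apply: mvec.
move=> _ [U oU <-]; rewrite setTI.
rewrite (_ : vec @^-1` U =
    \bigcup_(p in [set p | box p `<=` U]) (vec @^-1` box p)); last first.
  apply/seteqP; split => [t /= Ut|t [p /= pU pt]]; last exact: pU.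
  by have [p pt pU] := open_box oU Ut; exists p.
rewrite bigcup_mkcond; apply: countable_bigcupT_measurable => // p.
case: ifPn => // _.
rewrite (_ : _ @^-1` _ = \bigcap_(i in [set: 'I_d]) ((@tnth d (measurableTypeR R))^~ i @^-1`
    `]ratr (tnth p.1 i), (ratr (tnth p.1 i) + p.2.+1%:R^-1)%R[)).
  apply: fin_bigcap_measurable => // i _.
  by rewrite -[X in measurable X]setTI; apply: measurable_tnth.
apply/seteqP; split => t /= H i.
  by move=> _; have := H i; rewrite /= in_itv/= mxE.
by have := H i I; rewrite /= in_itv/= mxE.
Qed.

Definition lebesgue_euclid : set (euclid R d) -> \bar R :=
  pushforward (lebesgue_tuple R d) vec.

Let lebesgue0 : lebesgue_euclid set0 = 0.
Proof. by rewrite /lebesgue_euclid /pushforward preimage_set0 measure0. Qed.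

Let lebesgue_ge0 A : 0 <= lebesgue_euclid A.
Proof. by rewrite /lebesgue_euclid /pushforward; exact: measure_ge0. Qed.

Let lebesgue_sigma_additive : semi_sigma_additive lebesgue_euclid.
Proof.
move=> F mF tF mUF; rewrite /lebesgue_euclid /pushforward preimage_bigcup.
apply: measure_semi_sigma_additive.
- by move=> i; rewrite -[X in measurable X]setTI; exact: measurable_vec.
- apply/trivIsetP => /= i j _ _ ij; rewrite -preimage_setI.
  by move/trivIsetP : tF => /(_ _ _ _ _ ij) ->//; rewrite preimage_set0.
- by rewrite -preimage_bigcup -[X in measurable X]setTI; exact: measurable_vec.
Qed.

HB.instance Definition _ := isMeasure.Build _ _ _ lebesgue_euclid
  lebesgue0 lebesgue_ge0 lebesgue_sigma_additive.

Lemma lebesgue_euclid_box (a b : 'rV[R]_d) :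
  (forall i, (a ord0 i <= b ord0 i)%R) ->
  lebesgue_euclid [set v | forall i, (a ord0 i <= v ord0 i <= b ord0 i)%R] =
  (\prod_(i < d) (b ord0 i - a ord0 i))%:E.
Proof.
move=> ab; rewrite /lebesgue_euclid /pushforward.
pose a' := [tuple a ord0 i | i < d]; pose b' := [tuple b ord0 i | i < d].
have := @lebesgue_tuple_box R d a' b'.
under eq_bigr do rewrite !tnth_mktuple.
move=> <-; last by move=> i; rewrite !tnth_mktuple.
congr (lebesgue_tuple R d _); apply/seteqP.
by split => t /= H i; have := H i; rewrite ?mxE !tnth_mktuple.
Qed.

End lebesgue_euclid.

Definition mass_distribution (R : realType) (d : nat)
    (mu : {finite_measure set (euclid R d) -> \bar R}) : Prop :=
  (exists2 f : euclid R d -> R,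
     (@lebesgue_euclid R d).-integrable setT (EFin \o f) &
     forall A, measurable A ->
       mu A = (\int[@lebesgue_euclid R d]_(x in A) (f x)%:E)%E) /\
  (forall U : set 'rV[R]_d, open U -> U !=set0 -> (0 < mu U)%E).

Section hyperplanes.
Variables (R : realType) (d : nat).

Definition dotv (u x : 'rV[R]_d) : R := \sum_(i < d) u ord0 i * x ord0 i.

(* The hyperplane { x | dotv hnormal x = hoffset }. *)
Record hyperplane := Hyperplane {
  hnormal : 'rV[R]_d;
  hoffset : R;
  hnormal_neq0 : hnormal != 0 }.

Definition parallel (H K : hyperplane) : Prop :=
  exists c : R, hnormal K = c *: hnormal H.

(* Closed half-spaces; which side contains the boundary is immaterial, since
   hyperplanes are null sets for a mass distribution. *)
Definition halfspace (H : hyperplane) (s : bool) : set 'rV[R]_d :=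
  if s then [set x | hoffset H <= dotv (hnormal H) x]
  else [set x | dotv (hnormal H) x <= hoffset H].

(* l distinct parallel hyperplanes, listed in order along a common normal. *)
Record parallel_hyperplanes (l : nat) := ParallelHyperplanes {
  pnormal : 'rV[R]_d;
  poffset : 'I_l -> R;
  pnormal_neq0 : pnormal != 0;
  poffset_lt : forall i j : 'I_l, (i < j)%N -> poffset i < poffset j }.

Definition pnth (l : nat) (P : parallel_hyperplanes l) (j : 'I_l) : hyperplane :=
  Hyperplane (poffset P j) (pnormal_neq0 P).

(* The i-th of the l + 1 consecutive regions: it lies between the hyperplanes
   number i - 1 and i, with no constraint on the missing side for i = 0, l. *)
Definition region (l : nat) (P : parallel_hyperplanes l) (i : 'I_l.+1) :
    set 'rV[R]_d :=
  [set x | forall j : 'I_l,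
     if (j < i)%N then halfspace (pnth P j) true x
     else halfspace (pnth P j) false x].

Definition box (l : nat) (P : parallel_hyperplanes l) (H K : hyperplane)
    (i : 'I_l.+1) (s t : bool) : set 'rV[R]_d :=
  region P i `&` halfspace H s `&` halfspace K t.

Definition non_parallel (l : nat) (P : parallel_hyperplanes l)
    (H K : hyperplane) : Prop :=
  [/\ forall j : 'I_l, ~ parallel (pnth P j) H,
      forall j : 'I_l, ~ parallel (pnth P j) K & ~ parallel H K].

Definition equipartition (mu : set (euclid R d) -> \bar R) (l : nat)
    (P : parallel_hyperplanes l) (H K : hyperplane) : Prop :=
  forall (i : 'I_l.+1) (s t : bool),
    mu (box P H K i s t) = ((4 * l.+1)%:R^-1%:E * mu setT)%E.

End hyperplanes.

(* Main.v *)
(* Each direction u determines the 2k parallel hyperplanes cutting mu into 2k+1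
   equal regions, and each of two further directions v, w determines the
   hyperplane bisecting the middle region.  Opposite regions are exchanged by
   u -> -u, so the defects from an equipartition form 6k+1 functions of (u, v, w)
   that change sign, under the antipodes of the three spheres, according to
   characters whose product, as linear forms over F_2, is
   (x_2 + x_3) (P_3 / x_1)^k.  A common zero exists by a Borsuk-Ulam theorem on
   products of spheres.

   That theorem is proved by counting modulo 2.  A grid on a product of cubes,
   with opposite faces identified, models a product of projective spaces.  The
   signs of the functions at the cells of the grid give cocycles, and the value
   of their cup product on all top cells is the coefficient of x^a in the product
   of the linear forms: by Stokes' formula, removing the last factor amounts to
   slicing the grid in the middle of one of its blocks.  If this value is not
   zero, some cell is near sign changes of all the functions; then refine. *)

Require Import Defs.
From HB Require Import structures.
From mathcomp Require Import all_boot all_order all_algebra.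
From mathcomp Require Import all_classical all_reals all_analysis.
From mathcomp Require Import zify ring lra.
From mathcomp Require mpoly.
Import (canonicals, coercions) mpoly.

Set Implicit Arguments.
Unset Strict Implicit.
Unset Printing Implicit Defensive.

Import Order.TTheory GRing.Theory Num.Theory.
Import numFieldNormedType.Exports.

Local Open Scope ring_scope.

(** * Cubical cochains modulo 2 *)

Lemma addFF (x : 'F_2) : x + x = 0.
Proof. by case: x => -[|[|//]] ?; apply/val_inj. Qed.

Lemma F2_cases (a : 'F_2) : a = 0 \/ a = 1.
Proof. by case: a => -[|[|//]] ?; [left|right]; apply/val_inj. Qed.

(** Off-diagonal pairs come in twos under swapping the indices, and equal terms cancel in
    characteristic 2; [enum_rank] only selects one pair of each two. *)
Lemma sum_sym2 (T : finType) (P : pred T) (F : T -> T -> 'F_2) :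
  (forall i j, F i j = F j i) ->
  \sum_(i | P i) \sum_(j | P j && (j != i)) F i j = 0.
Proof.
move=> Fsym; rewrite pair_big_dep /=.
rewrite (bigID (fun p : T * T => (enum_rank p.1 < enum_rank p.2)%N)) /=.
rewrite [X in _ + X](reindex_inj (h := fun p : T * T => (p.2, p.1))) /=; last first.
  by move=> [a b] [a' b'] [-> ->].
rewrite [X in _ + X](eq_big (fun p : T * T => [&& P p.1, P p.2 & p.2 != p.1]
   && (enum_rank p.1 < enum_rank p.2)%N) (fun p : T * T => F p.1 p.2)) ?addFF//.
move=> [i j] /=; rewrite -leqNgt leq_eqVlt (inj_eq val_inj) (inj_eq enum_rank_inj).
rewrite [j == i]eq_sym; case: eqVneq => [->|_]; rewrite ?andbF ?ltnn ?andbF//= !andbT.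
by rewrite [P j && _]andbC.
Qed.

Section Cubical.
Variables (n d M : nat).
Notation N := (4 * M)%N.
Notation idx := ('I_n * 'I_d)%type.
(* The cells of a cube of side 2M cut into unit cubes, in doubled barycentric
   coordinates: the odd entries are the directions spanned by the cell. *)
Definition cell := {ffun idx -> 'I_N.+1}.
Implicit Types (v u : cell) (i j : idx) (x : 'I_N.+1) (W s : cell -> 'F_2).

Definition upd v i x : cell := [ffun j => if j == i then x else v j].

Definition step x (e : bool) : 'I_N.+1 := inord (if e then x.+1 else x.-1).

(** The cubical coboundary: the sum runs over the facets of [v], without signs because the
    coefficients are in ['F_2]. *)
Definition cobd W v := \sum_(i | odd (v i)) \sum_(e : bool) W (upd v i (step (v i) e)).

Lemma updE v i x j : upd v i x j = if j == i then x else v j.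
Proof. by rewrite ffunE. Qed.

Lemma upd_id v i : upd v i (v i) = v.
Proof. by apply/ffunP => j; rewrite updE; case: eqP => [->|]. Qed.

Lemma upd_upd v i x y : upd (upd v i x) i y = upd v i y.
Proof. by apply/ffunP => j; rewrite !updE; case: eqP. Qed.

Lemma updC v i j x y : i != j -> upd (upd v i x) j y = upd (upd v j y) i x.
Proof.
move=> ij; apply/ffunP => k; rewrite !updE.
by case: (k =P j) => [->|//]; rewrite eq_sym (negPf ij).
Qed.

Lemma odd_lt x : odd x -> (0 < x < N)%N.
Proof.
have := ltn_ord x; rewrite ltnS leq_eqVlt => /predU1P[->|]; first by rewrite oddM.
by move=> -> ; rewrite andbT; case: (nat_of_ord x).
Qed.

Lemma val_step x e : odd x -> step x e = (if e then x.+1 else x.-1) :> nat.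
Proof. by move=> /odd_lt xN; rewrite inordK//; case: e; lia. Qed.

Lemma odd_step x e : odd x -> odd (step x e) = false.
Proof.
move=> ox; rewrite val_step//; case: e => /=; first by rewrite ox.
by have := odd_lt ox; case: (nat_of_ord x) ox => //= y /negPf ->.
Qed.

(** Every face of codimension 2 is reached twice, once for each order of its two directions; no
    direction is collapsed twice, since [step] makes its entry even. *)
Lemma cobd_cobd W v : cobd (cobd W) v = 0.
Proof.
pose F i j := \sum_e \sum_e' W (upd (upd v i (step (v i) e)) j (step (v j) e')).
rewrite -[RHS](@sum_sym2 _ (fun i => odd (v i))
  (fun i j => if j == i then 0 else F i j)); last first.
  move=> i j; rewrite eq_sym; case: eqVneq => // ij.
  rewrite /F exchange_big; apply: eq_bigr => e _; apply: eq_bigr => e' _.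
  by rewrite updC.
apply: eq_bigr => i oi.
transitivity (\sum_e \sum_(j | odd (v j) && (j != i)) \sum_e'
   W (upd (upd v i (step (v i) e)) j (step (v j) e'))).
  apply: eq_bigr => e _; apply: eq_big => j.
    by rewrite updE; case: eqVneq => [->|]; rewrite ?odd_step ?andbF ?andbT.
  by rewrite updE; case: eqVneq => [_|//]; rewrite odd_step.
by rewrite exchange_big; apply: eq_bigr => j /andP[_ /negPf ->].
Qed.

Lemma cobd1 v : cobd (fun=> 1) v = 0.
Proof. by apply: big1 => i _; rewrite big_bool /= addFF. Qed.

Section cup.
Variable s : nat -> cell -> 'F_2.

(* The cup product of the coboundaries of [s 0], ..., [s (k - 1)], evaluated on
   the barycentric subdivision of a cell. *)
Fixpoint cup k : cell -> 'F_2 :=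
  if k is k'.+1 then cobd (fun v => cup k' v * s k' v) else fun=> 1.

Lemma cobd_cup k v : cobd (cup k) v = 0.
Proof. by case: k => [|k]; [exact: cobd1|exact: cobd_cobd]. Qed.

(** Adding [cobd W v * h v], which vanishes, leaves only the jumps of [h] between [v] and its
    facets. *)
Lemma cobdM W h v : cobd W v = 0 -> cobd (fun u => W u * h u) v =
  \sum_(i | odd (v i)) \sum_e
     W (upd v i (step (v i) e)) * (h (upd v i (step (v i) e)) + h v).
Proof.
move=> W0; have <- : cobd (fun u => W u * h u) v + cobd W v * h v =
    cobd (fun u => W u * h u) v by rewrite W0 mul0r addr0.
rewrite /cobd mulr_suml -big_split; apply: eq_bigr => i _ /=.
rewrite mulr_suml -big_split; apply: eq_bigr => e _ /=.
by rewrite mulrDr.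
Qed.

Definition near_cell k u v := forall i, (u i <= v i + k)%N /\ (v i <= u i + k)%N.

(** By [cobdM] there is a nonzero term: the last factor jumps between [v] and a facet, and the
    shorter product is nonzero at that facet, where the induction continues. Each descent moves the
    entries by at most 1. *)
Lemma cup_neq0 k v : cup k v != 0 -> forall j : nat, (j < k)%N ->
  exists u u', [/\ near_cell k u v, near_cell k u' v & s j u != s j u'].
Proof.
elim: k v => [//|k IH] v.
rewrite [cup _ _]cobdM ?cobd_cup// => Wv.
have /existsP[i /existsP[e /andP[oi]]] : [exists i, exists e : bool, odd (v i) &&
    (cup k (upd v i (step (v i) e)) * (s k (upd v i (step (v i) e)) + s k v) != 0)].
  apply: contraNT Wv => /existsPn H; apply/eqP.
  apply: big1 => i oi; apply: big1 => e _; apply/eqP.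
  by have /existsPn/(_ e) := H i; rewrite oi negbK.
set w := upd _ _ _ => wv.
have nw : near_cell 1 w v.
  move=> j; rewrite updE; case: eqP => [->|_]; last lia.
  by rewrite val_step//; have := odd_lt oi; case: (e); lia.
move=> j; rewrite ltnS leq_eqVlt => /predU1P[->|jk].
  exists w, v; split; [|by move=> ?; lia|].
    by move=> i'; have := nw i'; lia.
  by apply: contraNN wv => /eqP ->; rewrite addFF mulr0.
have [|u [u' [nu nu' uu']]] := IH w _ j jk.
  by apply: contraNN wv => /eqP ->; rewrite mul0r.
exists u, u'; split => // i'; have := nu i'; have := nu' i'; have := nw i'; lia.
Qed.

End cup.

(** * Gluing opposite faces of the grid *)

Definition flip i v : cell :=
  [ffun j : idx => if (j.1 == i.1) && (i.2 < j.2)%N then rev_ord (v j) else v j].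

(* The identification of the face [v i = 0] of the grid with the face [v i = N];
   the quotient of one block of the grid by these maps is a projective space. *)
Definition tau i v : cell := upd (flip i v) i ord_max.

Lemma flipE i v j :
  flip i v j = if (j.1 == i.1) && (i.2 < j.2)%N then rev_ord (v j) else v j.
Proof. by rewrite ffunE. Qed.

Lemma tauE i v j : tau i v j = if j == i then ord_max else flip i v j.
Proof. by rewrite updE. Qed.

Lemma flipK i : involutive (flip i).
Proof.
by move=> v; apply/ffunP => j; rewrite !flipE; case: ifP => H; rewrite ?H ?rev_ordK.
Qed.

Lemma odd_rev x : odd (rev_ord x) = odd x.
Proof. by have := ltn_ord x; rewrite ltnS /= subSS => xN; rewrite oddB// oddM. Qed.

Lemma odd_flip i v j : odd (flip i v j) = odd (v j).
Proof. by rewrite flipE; case: ifP => _; rewrite ?odd_rev. Qed.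

Lemma step_rev x e : odd x -> step (rev_ord x) e = rev_ord (step x (~~ e)).
Proof.
move=> ox; apply: val_inj; rewrite /= !val_step ?odd_rev//=.
by have := odd_lt ox; case: e => /=; lia.
Qed.

Lemma upd_flip i v j x : upd (flip i v) j x =
  flip i (upd v j (if (j.1 == i.1) && (i.2 < j.2)%N then rev_ord x else x)).
Proof.
apply/ffunP => k; rewrite updE !flipE updE; case: eqP => [->|_//].
by case: ifP => H; rewrite ?H ?rev_ordK.
Qed.

Lemma tau_upd0 i v x : tau i (upd v i x) = tau i v.
Proof. by apply/ffunP => k; rewrite !tauE !flipE updE; case: (k == i). Qed.

Section cup_tau.
Variables (s : nat -> cell -> 'F_2) (al : nat -> 'I_n -> 'F_2).
Hypothesis s_tau : forall k i u, (0 < i.2)%N -> u i = ord0 ->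
  s k (tau i u) = s k u + al k i.1.

(** On the face [u i = ord0], [tau i] carries facets to facets, and [cup] depends only on
    differences of values of [s], in which the constants [al k i.1] cancel. *)
Lemma cup_tau k i u : (0 < i.2)%N -> u i = ord0 -> cup s k (tau i u) = cup s k u.
Proof.
move=> i0; elim: k u => // k IH u ui /=.
rewrite !cobdM ?cobd_cup//; apply: eq_big => [j|j].
  by rewrite tauE; case: eqVneq => [->|_]; rewrite ?odd_flip// ui oddM.
rewrite tauE; case: eqVneq => [_|ji]; rewrite ?odd_flip ?oddM// => oj.
pose fj := (j.1 == i.1) && (i.2 < j.2)%N.
(* A reversed coordinate has its two end facets exchanged. *)
rewrite (reindex_inj (h := fun e : bool => e (+) fj)); last exact: addIb.
apply: eq_bigr => e _ /=.
have -> : upd (tau i u) j (step (flip i u j) (e (+) fj)) = tau i (upd u j (step (u j) e)).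
  rewrite /tau updC 1?eq_sym// upd_flip flipE -/fj.
  by case: fj; rewrite ?addbT ?addbF // step_rev// negbK rev_ordK.
rewrite IH ?updE 1?eq_sym ?(negPf ji)//; congr (_ * _).
rewrite !s_tau ?updE 1?eq_sym ?(negPf ji)//.
by rewrite addrACA addFF addr0.
Qed.
End cup_tau.

(** The midpoint is even and fixed by [rev_ord], so the slice there is again a cubical grid
    compatible with the gluing. *)
Definition mid : 'I_N.+1 := inord (2 * M).

Lemma val_mid : mid = (2 * M)%N :> nat.
Proof. by rewrite inordK//; lia. Qed.

Lemma odd_mid : odd mid = false.
Proof. by rewrite val_mid oddM. Qed.

Lemma rev_mid : rev_ord mid = mid.
Proof. by apply: val_inj; rewrite /= val_mid; lia. Qed.

(** * Slices of the grid and Stokes' formula *)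

Implicit Type A : {set idx}.

(* The cells that are top-dimensional in the directions [A] and lie in the
   middle of the grid in the other directions. *)
Definition slice A v := [forall i, if i \in A then odd (v i) else v i == mid].

Definition total A W := \sum_(v | slice A v) W v.

Lemma sliceP A v i : slice A v -> if i \in A then odd (v i) else v i == mid.
Proof. by move/forallP. Qed.

Lemma slice_odd A v i : slice A v -> odd (v i) = (i \in A).
Proof. by move=> /sliceP-/(_ i); case: ifP => // _ /eqP ->; rewrite odd_mid. Qed.

Lemma slice_mid A v i : slice A v -> i \notin A -> v i = mid.
Proof. by move=> /sliceP-/(_ i); case: ifP => // _ /eqP. Qed.

Lemma slice_flip A i v : slice A (flip i v) = slice A v.
Proof.
apply: eq_forallb => j; rewrite odd_flip; case: ifP => // _.
by rewrite flipE; case: ifP => // _; rewrite -{1}rev_mid (inj_eq rev_ord_inj).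
Qed.

Lemma sum_slice A i (G : cell -> 'F_2) : i \in A ->
  \sum_(v | slice A v) G v =
  \sum_(u | slice (A :\ i) u) \sum_(x : 'I_N.+1 | odd x) G (upd u i x).
Proof.
move=> iA; rewrite (partition_big (fun v => upd v i mid) (slice (A :\ i))) /=; last first.
  move=> v /forallP Av; apply/forallP => j; rewrite !inE updE.
  by case: eqP => [->|_] //=.
apply: eq_bigr => u Au.
have ui : u i = mid by rewrite (slice_mid Au)// !inE eqxx.
rewrite (reindex_onto (upd u i) (fun v => v i)) /=; last first.
  by move=> v /andP[_ /eqP <-]; rewrite upd_upd upd_id.
apply: eq_bigl => x; rewrite upd_upd -[in X in _ == X](upd_id u i) ui eqxx updE eqxx eqxx !andbT.
apply/forallP/idP => [/(_ i)|ox j]; first by rewrite iA updE eqxx.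
have := sliceP j Au; rewrite !inE updE; case: eqP => [->|//].
by rewrite iA.
Qed.

(** Modulo 2 the sum telescopes: each inner even point is a neighbour of two odd points. *)
Lemma sum_odd_step (g : 'I_N.+1 -> 'F_2) :
  \sum_(x : 'I_N.+1 | odd x) \sum_e g (step x e) = g ord0 + g ord_max.
Proof.
pose g' (k : nat) := g (inord k).
have -> : g ord0 = g' 0%N by congr g; apply: val_inj; rewrite /= inordK.
have -> : g ord_max = g' N by congr g; apply: val_inj; rewrite /= inordK.
transitivity (\sum_(0 <= x < N.+1 | odd x) (g' x.-1 + g' x.+1)).
  by rewrite big_mkord; apply: eq_bigr => x _; rewrite big_bool addrC.
rewrite big_mkcond; have -> : N = (2 * M).*2 by lia.
elim: (2 * M)%N => [|K IH]; first by rewrite big_nat1 addFF.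
rewrite doubleS 2?big_nat_recr//= IH odd_double/= addr0.
by rewrite addrA -[_ + _ + g' K.*2]addrA addFF addr0.
Qed.

(** Stokes' formula: along each direction the inner facets cancel and only the two opposite faces
    remain. *)
Lemma total_cobd A G : total A (cobd G) =
  \sum_(i in A) \sum_(u | slice (A :\ i) u) (G (upd u i ord0) + G (upd u i ord_max)).
Proof.
transitivity (\sum_(v | slice A v) \sum_(i in A) \sum_e G (upd v i (step (v i) e))).
  by apply: eq_bigr => v Av; apply: eq_bigl => i; rewrite (slice_odd i Av).
rewrite exchange_big; apply: eq_bigr => i iA.
rewrite (sum_slice _ iA); apply: eq_bigr => u _.
rewrite -(sum_odd_step (fun x => G (upd u i x))).
by apply: eq_bigr => x _; apply: eq_bigr => e _; rewrite upd_upd updE eqxx.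
Qed.

(** * Removing factors from the cup product *)

Section recursion.
Hypothesis M_gt0 : (0 < M)%N.
Variables (s : nat -> cell -> 'F_2) (al : nat -> 'I_n -> 'F_2).
Hypothesis s_tau : forall k i u, (0 < i.2)%N -> u i = ord0 ->
  s k (tau i u) = s k u + al k i.1.

Definition face_total k A i := \sum_(u | slice (A :\ i) u) cup s k (upd u i ord0).

Lemma sum_tau A i (G : cell -> 'F_2) :
  \sum_(u | slice A u) G (upd u i ord_max) =
  \sum_(u | slice A u) G (tau i (upd u i ord0)).
Proof.
rewrite (reindex_inj (can_inj (flipK i))) /=.
by apply: eq_big => u; rewrite ?slice_flip ?tau_upd0.
Qed.

(** After Stokes' formula the gluing pairs the two opposite faces; the cup products agree on them,
    so only the jump [be i] of [h] survives. *)
Lemma total_cup_mul k A (h : cell -> 'F_2) (be : idx -> 'F_2) :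
  (forall i, i \in A -> (0 < i.2)%N) ->
  (forall i u, i \in A -> slice (A :\ i) u ->
     h (tau i (upd u i ord0)) = h (upd u i ord0) + be i) ->
  total A (cobd (fun v => cup s k v * h v)) = \sum_(i in A) be i * face_total k A i.
Proof.
move=> A0 htau; rewrite total_cobd; apply: eq_bigr => i iA.
rewrite big_split /= (sum_tau _ _ (fun v => cup s k v * h v)) -big_split mulr_sumr.
apply: eq_bigr => u Au /=.
rewrite (cup_tau s_tau) ?A0 ?updE ?eqxx// htau// mulrDr addrA addFF add0r.
by rewrite mulrC.
Qed.

Variable a : 'I_n -> nat.
Hypothesis a_lt : forall b, (a b < d)%N.

Definition active (a : 'I_n -> nat) : {set idx} := [set i : idx | (0 < i.2 <= a i.1)%N].

(* The coboundary of the indicator of [v p > mid], for the top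
   coordinate [p] of a block localises on the slice [v p = mid]. *)
Lemma face_total_slice k b (p : idx) : p.1 = b -> p.2 = a b :> nat -> (0 < a b)%N ->
  \sum_(i in active a | i.1 == b) face_total k (active a) i =
  total (active a :\ p) (cup s k).
Proof.
set A := active a => pb pa ab.
have pA : p \in A by rewrite inE pa pb ab/=.
pose h v : 'F_2 := (2 * M < v p)%N%:R.
transitivity (\sum_(i in A) (i.1 == b)%:R * face_total k A i).
  by rewrite big_mkcondr; apply: eq_bigr => i _; case: eqP; rewrite ?mul1r ?mul0r.
rewrite -(@total_cup_mul k A h (fun i => (i.1 == b)%:R)); last 2 first.
- by move=> i; rewrite inE => /andP[].
- move=> i u iA Au; rewrite /h tauE flipE !updE.
  case: (eqVneq p i) => [<-|pi]; first by rewrite pb eqxx /= add0r; have -> : (2 * M < N)%N by lia.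
  have iA2 : (0 < i.2 <= a i.1)%N by move: iA; rewrite inE.
  rewrite pb eq_sym; case: eqVneq => [ib|_]; last by rewrite addr0.
  have -> : (i.2 < p.2)%N.
    rewrite ltn_neqAle pa -{2}ib; move: iA2 => /andP[_ ->]; rewrite andbT.
    apply: contra_neq pi => ia; rewrite [p]surjective_pairing [i]surjective_pairing.
    by rewrite pb ib; congr pair; apply: val_inj; rewrite /= pa.
  (* For [i] below [p] in the same block, the gluing reverses coordinate [p]. Its entry is odd,
     hence never [2 * M], so the reversal always switches the indicator. *)
  have := slice_odd p Au; rewrite in_setD1 pi pA /= => op.
  have := odd_lt op => up.
  have [x ux] : exists x : nat, (u p = x.*2.+1 :> nat)%N.
    by exists (u p)./2; rewrite -[LHS]odd_double_half op.
  apply/esym; rewrite /= ux; case: ltnP => H; case: ltnP => H'; rewrite ?addFF ?add0r//; lia.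
rewrite /total (sum_slice _ pA); apply: eq_bigr => u Au.
have up : u p = mid by rewrite (slice_mid Au)// !inE eqxx.
(* The indicator is constant on a cell and its facets unless the entry at [p] is [2 * M + 1], when
   the lower facet lies on the slice. *)
have jump v : odd (v p) -> cobd (fun u => cup s k u * h u) v =
    if v p == (2 * M).+1 :> nat then cup s k (upd v p mid) else 0.
  move=> op; rewrite cobdM ?cobd_cup// (bigD1 p)//= [X in _ + X]big1 ?addr0.
    rewrite big_bool /h !updE eqxx !val_step//=.
    have [vp|vp] := eqVneq.
      rewrite vp ltnS leqnSn ltnSn ltnn addFF mulr0 add0r add0r mulr1.
      by congr (cup _ _ (upd _ _ _)); apply: ord_inj; rewrite val_step// val_mid vp.
    have -> : (2 * M < (v p).+1)%N = (2 * M < v p)%N.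
      have [x vx] : exists x : nat, (v p = x.*2.+1 :> nat)%N.
        by exists (v p)./2; rewrite -[LHS]odd_double_half op.
      by move: vp; rewrite vx; lia.
    have -> : (2 * M < (v p).-1)%N = (2 * M < v p)%N by lia.
    by rewrite addFF !mulr0 addr0.
  move=> i /andP[_ ip]; apply: big1 => e _.
  by rewrite /h updE eq_sym (negPf ip) addFF mulr0.
have M2 : ((2 * M).+1 < N.+1)%N by lia.
rewrite (bigD1 (inord (2 * M).+1)) /= ?inordK/= ?oddM//.
rewrite jump updE eqxx ?inordK/= ?eqxx ?oddM//.
rewrite upd_upd -up upd_id big1 ?addr0// => x /andP[ox xM].
rewrite jump updE eqxx//; case: eqP => // xM'.
by case/eqP: xM; apply: val_inj; rewrite /= inordK.
Qed.

(** Apply [total_cup_mul] to [s k] and group the faces by block; [face_total_slice] turns each group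
    into a slice in which block [b] has lost its top active direction. *)
Lemma total_cupS k :
  total (active a) (cup s k.+1) = \sum_b al k b *
    (if (0 < a b)%N then total (active (fun c => a c - (c == b))%N) (cup s k) else 0).
Proof.
rewrite (@total_cup_mul _ _ _ (fun i => al k i.1)); last 2 first.
- by move=> i; rewrite inE => /andP[].
- by move=> i u; rewrite inE => /andP[i0 _] _; rewrite s_tau ?updE ?eqxx.
rewrite (partition_big fst predT)//=; apply: eq_bigr => b _.
rewrite (eq_bigr (fun i => al k b * face_total k (active a) i)); last first.
  by move=> i /andP[_ /eqP ->].
rewrite -mulr_sumr; congr (_ * _); case: ifPn => ab; last first.
  rewrite big1// => i; rewrite inE => /andP[/andP[i0 ia] /eqP ib].
  by move: ab; rewrite -ib (leq_trans i0 ia).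
rewrite (@face_total_slice k b (b, Ordinal (a_lt b)))//; congr (total _ _).
apply/setP => -[c j]; rewrite !inE xpair_eqE.
by case: eqVneq => [->|_] /=; rewrite ?subn0// -val_eqE/=; lia.
Qed.

(** The constant 1 is summed over the odd entries in each active direction, and their number [2 * M]
    is even; without active directions a single cell remains. *)
Lemma total_cup0 : total (active a) (cup s 0) = [forall b, a b == 0%N]%:R.
Proof.
case: (boolP [forall _, _]) => [/forallP a0|]; last first.
  rewrite negb_forall => /existsP[b]; rewrite -lt0n => ab.
  rewrite /total (sum_slice (i := (b, Ordinal (a_lt b)))); last by rewrite inE /= ab /=.
  apply: big1 => u _; transitivity (\sum_(0 <= x < N.+1 | odd x) (1 : 'F_2)).
    by rewrite big_mkord.
  rewrite big_mkcond; elim: (M) => [|K IH]; first by rewrite big_nat1.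
  rewrite (_ : 4 * K.+1 = (4 * K).+4)%N; last lia.
  do 4 rewrite big_nat_recr//=; rewrite IH negbK oddM/=.
  by rewrite !addr0 add0r addFF.
rewrite /total (big_pred1 [ffun=> mid])// => v; apply/idP/eqP => [av|->].
  apply/ffunP => i; rewrite ffunE (slice_mid av)// inE (eqP (a0 _)).
  by case: (nat_of_ord i.2).
by apply/forallP => i; rewrite !inE ffunE eqxx (eqP (a0 _)); case: (nat_of_ord i.2).
Qed.

End recursion.
End Cubical.

(** * Coefficients of products of linear forms *)

Section polynomials.
Variable n : nat.
Implicit Types (P : mpoly.mpoly n 'F_2) (m : mpoly.multinom n).

Lemma mcoeffMXU P m b : mpoly.mcoeff m (P * mpoly.mpolyX 'F_2 (mpoly.mnm1 b)) =
  if (0 < m b)%N then mpoly.mcoeff (mpoly.mnm_sub m (mpoly.mnm1 b)) P else 0.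
Proof.
case: ifPn => [mb|]; last first.
  rewrite -eqn0Ngt => /eqP mb; rewrite [P]mpoly.mpolyE mulr_suml raddf_sum /=.
  apply: big1_seq => m' _; rewrite -scalerAl -mpoly.mpolyXD mpoly.mcoeffZ mpoly.mcoeffX.
  case: eqP => [mm'|_]; last by rewrite mulr0.
  by move: mb; rewrite -mm' mpoly.mnmDE mpoly.mnm1E eqxx addn1.
have {1}-> : m = mpoly.mnm_add (mpoly.mnm1 b) (mpoly.mnm_sub m (mpoly.mnm1 b)).
  apply/mpoly.mnmP => i; rewrite mpoly.mnmDE mpoly.mnmBE mpoly.mnm1E.
  by case: eqP => [<-|_]; rewrite ?subn0 // subnKC.
by rewrite mpoly.mcoeffMX.
Qed.

(** The ideal is monomial: if every monomial of the support had an exponent at least [d], dividing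
    each by a suitable [d]-th power would exhibit membership. *)
Lemma not_in_ideal d P :
  ~ in_ideal (fun i : 'I_n => mpoly.mpolyX 'F_2 (mpoly.mnm1 i) ^+ d) P ->
  exists2 m : mpoly.multinom n, forall b, (m b < d)%N & mpoly.mcoeff m P != 0.
Proof.
move=> PI; apply: contrapT => H; apply: PI.
have big (m : mpoly.multinom n) : mpoly.mcoeff m P != 0 -> exists b, (d <= m b)%N.
  move=> mP; apply: contrapT => nb; apply: H; exists m => // b.
  by rewrite ltnNge; apply/negP => db; apply: nb; exists b.
pose f (m : mpoly.multinom n) := [pick b | (d <= m b)%N].
exists (fun b => \sum_(m <- mpoly.msupp P | f m == Some b)
  mpoly.mcoeff m P *: mpoly.mpolyX 'F_2 (mpoly.mnm_sub m (mpoly.mnm_muln (mpoly.mnm1 b) d))).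
rewrite {1}[P]mpoly.mpolyE.
under [RHS]eq_bigr do rewrite mulr_suml big_mkcond /=.
rewrite exchange_big /=; apply: eq_big_seq => m; rewrite mpoly.mcoeff_msupp => mP.
have [b fm db] : exists2 b, f m = Some b & (d <= m b)%N.
  rewrite /f; case: pickP => [b db|nb]; first by exists b.
  by have [b] := big _ mP; rewrite nb.
rewrite (bigD1 b)//= fm eqxx big1 ?addr0; last first.
  by move=> b' b'b; case: eqP => // -[bb]; rewrite bb eqxx in b'b.
rewrite -scalerAl mpoly.mpolyXn -mpoly.mpolyXD; congr (_ *: mpoly.mpolyX _ _).
apply/mpoly.mnmP => i; rewrite mpoly.mnmDE mpoly.mnmBE mpoly.mulmnE mpoly.mnm1E.
by case: eqP => [<-|_]; rewrite ?muln0 ?subn0 ?addn0 ?muln1 ?mul1n ?mul0n ?addn0 ?subn0 // subnK.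
Qed.

Definition linear_form (al : 'I_n -> 'F_2) : mpoly.mpoly n 'F_2 :=
  \sum_b al b *: mpoly.mpolyX 'F_2 (mpoly.mnm1 b).

(** Both sides obey the same recursion, [total_cupS] on the grid and [mcoeffMXU] for coefficients,
    with the same initial values. *)
Lemma total_cup_mcoeff d M (M_gt0 : (0 < M)%N) (s : nat -> cell n d M -> 'F_2)
    (al : nat -> 'I_n -> 'F_2) :
  (forall k (i : 'I_n * 'I_d) (u : cell n d M), (0 < i.2)%N -> u i = ord0 ->
    s k (tau i u) = s k u + al k i.1) ->
  forall k m, (forall b, (m b < d)%N) ->
  total (active d m) (cup s k) = mpoly.mcoeff m (\prod_(j < k) linear_form (al j)).
Proof.
move=> s_tau; elim=> [|k IH] m md.
  rewrite (total_cup0 M_gt0 s md) big_ord0 mpoly.mcoeff1; congr (nat_of_bool _)%:R.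
  apply/forallP/eqP => [m0|-> b]; last by rewrite mpoly.mnm0E.
  by apply/mpoly.mnmP => b; rewrite mpoly.mnm0E (eqP (m0 b)).
rewrite (total_cupS M_gt0 s_tau md) big_ord_recr /= /linear_form mulr_sumr raddf_sum.
apply: eq_bigr => b _; rewrite -scalerAr.
apply: etrans; last exact/esym/mpoly.mcoeffZ.
congr (_ * _); apply: etrans; last exact/esym/mcoeffMXU.
case: ifP => // mb; rewrite -IH; last first.
  by move=> c; rewrite mpoly.mnmBE (leq_ltn_trans (leq_subr _ _)).
congr (total _ _); apply/setP => i; rewrite !inE mpoly.mnmBE mpoly.mnm1E.
by rewrite [_ == b]eq_sym.
Qed.

End polynomials.

(** * A Borsuk-Ulam theorem for products of spheres *)

Local Open Scope classical_set_scope.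

Lemma cvg_mx (R : realType) m n (T : Type) (F : set_system T) {FF : Filter F}
    (f : T -> 'M[R]_(m, n)) (l : 'M[R]_(m, n)) :
  (forall i j, f x i j @[x --> F] --> l i j) -> f x @[x --> F] --> l.
Proof.
move=> fl A [P lP PA]; apply: (filterS PA); rewrite nbhs_simpl /=.
apply: filter_forall => i; apply: filter_forall => j; exact: fl (lP i j).
Qed.

Section borsuk_ulam.
Variables (R : realType) (n d : nat).
Local Notation idx := ('I_n * 'I_d)%type.
Implicit Types (x : 'M[R]_(n, d)) (w : 'rV[R]_(n * d)) (b : 'I_n) (i : 'I_d).

Definition neg_row b x : 'M[R]_(n, d) :=
  \matrix_(c, i) if c == b then - x c i else x c i.

Definition nz_rows x := forall b, row b x != 0.

(* A rational parametrisation of a hemisphere by a cube, up to scaling; the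
   coordinate 0 of a block is frozen to 1. *)
Definition coordinate w b i : R := if i == 0 :> nat then 1 else w ord0 (mxvec_index b i).

Definition sphere_map w : 'M[R]_(n, d) := \matrix_(b, i)
  (coordinate w b i * \prod_(k < d | (i < k)%N) (1 - coordinate w b k ^+ 2)).

Lemma nz_rows_sphere_map w : (0 < d)%N -> nz_rows (sphere_map w).
Proof.
move=> d0 b; pose P i := coordinate w b i != 0.
have P0 : P (Ordinal d0) by rewrite /P /coordinate eqxx oner_neq0.
case: (@arg_maxnP _ _ P (@nat_of_ord d) P0) => i Pi imax.
apply/eqP => /rowP/(_ i); rewrite !mxE => /eqP; apply/negP.
rewrite mulf_neq0//; apply/prodf_neq0 => k ik.
have [->|wk] := eqVneq (coordinate w b k) 0; first by rewrite expr0n subr0 oner_neq0.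
by have := imax k wk; rewrite /= leqNgt ik.
Qed.

Lemma sphere_map_continuous : continuous sphere_map.
Proof.
have cc b i : continuous (fun w => coordinate w b i).
  rewrite /coordinate; case: (_ == _ :> nat) => /=; first by apply: cst_continuous.
  exact: coord_continuous.
move=> w; apply: (@cvg_mx _ _ _ _ (nbhs w) (nbhs_filter w)) => b i; rewrite mxE.
under eq_cvg do rewrite mxE.
apply: cvgM; first exact: cc.
apply: cvg_big => [|k _]; first exact: mul_continuous.
by apply: cvgB; [exact: cvg_cst|apply: cvgM; exact: cc].
Qed.


(** Rescales the grid so that each coordinate runs over [-1, 1], with [mid] going to 0. *)
Definition grid_point M (v : cell n d M) : 'rV[R]_(n * d) :=
  mxvec (\matrix_(b, i) ((v (b, i))%:R / (2 * M)%:R - 1)).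

Lemma coordinate_grid M (v : cell n d M) b i : (0 < i)%N ->
  coordinate (grid_point v) b i = (v (b, i))%:R / (2 * M)%:R - 1.
Proof. by rewrite /coordinate mxvecE mxE; case: (nat_of_ord i). Qed.

(** When coordinate [i] is -1 or 1, its factor kills all earlier entries of the block. The entries
    from [i] on change sign, because [tau] negates their coordinates and the factors are even. *)
Lemma sphere_map_tau M (v : cell n d M) b i : (0 < M)%N -> (0 < i)%N ->
  v (b, i) = ord0 ->
  sphere_map (grid_point (tau (b, i) v)) = neg_row b (sphere_map (grid_point v)).
Proof.
move=> M0 i0 vi.
have MR : M%:R != 0 :> R by rewrite pnatr_eq0; lia.
have other (c : 'I_n) (k : 'I_d) : (c != b) || (k < i)%N ->
    coordinate (grid_point (tau (b, i) v)) c k = coordinate (grid_point v) c k.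
  have [k0|k0] := posnP k; first by rewrite /coordinate k0.
  move=> ck; rewrite !coordinate_grid// tauE flipE xpair_eqE /=.
  move: ck; case: eqVneq => //= _ ki; rewrite -val_eqE /= ltn_eqF//.
  by rewrite ltnNge (ltnW ki).
have above (k : 'I_d) : (i <= k)%N ->
    coordinate (grid_point (tau (b, i) v)) b k = - coordinate (grid_point v) b k.
  move=> ik; have k0 : (0 < k)%N by rewrite (leq_trans i0).
  rewrite !coordinate_grid// tauE flipE xpair_eqE eqxx /=.
  case: (eqVneq k i) => [->|ki].
    by rewrite vi mul0r /= !natrM; field.
  rewrite ltn_neqAle val_eqE eq_sym ki ik /= subSS natrB; last by rewrite -ltnS ltn_ord.
  by rewrite !natrM; field.
apply/matrixP => c k; rewrite !mxE; case: eqVneq => [->|cb]; last first.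
  by rewrite other ?cb//; congr (_ * _); apply: eq_bigr => l _; rewrite other ?cb.
have [ik|ki] := leqP i k.
  rewrite above// mulNr; congr (- (_ * _)); apply: eq_bigr => l kl.
  by rewrite above ?sqrrN// ltnW// (leq_ltn_trans ik).
by rewrite !(bigD1 i ki) /= (above i)// (coordinate_grid v b i0) vi mul0r; ring.
Qed.

Lemma grid_point_near M k (u v : cell n d M) l : (0 < M)%N -> near_cell k u v ->
  `|grid_point u 0 l - grid_point v 0 l| <= k%:R / (2 * M)%:R.
Proof.
move=> M0 uv; case/mxvec_indexP: l => b i; rewrite !mxvecE !mxE.
have M2 : 0 < (2 * M)%:R :> R by rewrite ltr0n; lia.
rewrite opprB addrA subrK -mulrBl normrM normfV (ger0_norm (ltW M2)).
rewrite ler_pM2r ?invr_gt0// ler_norml.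
have [h1 h2] := uv (b, i); apply/andP; split.
  by rewrite lerBrDr addrC lerBlDr -natrD ler_nat.
by rewrite lerBlDr addrC -natrD ler_nat.
Qed.

(** Selects one vector of each antipodal pair of nonzero vectors. *)
Definition first_pos (r : 'rV[R]_d) : bool :=
  if [pick i | r ord0 i != 0] is Some i then 0 < r ord0 i else false.

Lemma first_posN (r : 'rV[R]_d) : r != 0 -> first_pos (- r) = ~~ first_pos r.
Proof.
move=> r0; rewrite /first_pos (@eq_pick _ _ (fun i => r ord0 i != 0)); last first.
  by move=> i; rewrite mxE oppr_eq0.
case: pickP => [i ri|ri]; first by rewrite mxE oppr_gt0 -leNgt le_eqVlt (negPf ri).
by case/eqP: r0; apply/rowP => i; rewrite mxE; apply/eqP/negbFE/ri.
Qed.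

Section signs.
Variables (F : nat -> 'M[R]_(n, d) -> R) (al : nat -> 'I_n -> 'F_2).
Hypothesis F_neg : forall j b x, nz_rows x ->
  F j (neg_row b x) = if al j b == 0 then F j x else - F j x.

(* On the zero set of [F j] any function with the right equivariance will do. *)
Definition sign_bit j x : 'F_2 := if F j x == 0
  then \sum_b al j b * (first_pos (row b x))%:R else ((0 < F j x)%R)%:R.

Lemma sign_bit_neg j b x : nz_rows x ->
  sign_bit j (neg_row b x) = sign_bit j x + al j b.
Proof.
move=> x0; rewrite /sign_bit F_neg//.
have -> : ((if al j b == 0 then F j x else - F j x) == 0) = (F j x == 0).
  by case: ifP; rewrite ?oppr_eq0.
case: ifPn => [_|F0].
  rewrite (bigD1 b)// [in RHS](bigD1 b)//= addrAC.
  congr (_ + _); last first.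
    apply: eq_bigr => c cb; congr (_ * (first_pos _)%:R).
    by apply/rowP => i; rewrite !mxE (negPf cb).
  have -> : row b (neg_row b x) = - row b x by apply/rowP => i; rewrite !mxE eqxx.
  rewrite first_posN//; case: (first_pos _); rewrite ?mulr1 ?mulr0 ?addFF ?add0r//.
have [-> | ->] := F2_cases (al j b); first by rewrite eqxx addr0.
rewrite oner_eq0 oppr_gt0; case: ltgtP F0 => //= _ _; by rewrite ?addFF ?add0r.
Qed.

Lemma sign_bit_neq j x y : sign_bit j x != sign_bit j y ->
  ~ (0 < F j x /\ 0 < F j y) /\ ~ (F j x < 0 /\ F j y < 0).
Proof.
move=> /eqP xy; split => -[Fx Fy]; apply: xy; rewrite /sign_bit.
  by rewrite !gt_eqF// Fx Fy.
by rewrite !lt_eqF// !ltNge !ltW.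
Qed.

Hypothesis F_cont : forall j x, nz_rows x -> F j y @[y --> x] --> F j x.

(** At every refinement the nonzero coefficient yields a cell near sign changes of all the
    functions. At a cluster point of these cells a nonzero value would force a constant sign
    nearby. *)
Theorem borsuk_ulam_spheres (m : nat) (a : mpoly.multinom n) :
  (0 < d)%N -> (forall b, (a b < d)%N) ->
  mpoly.mcoeff a (\prod_(j < m) linear_form (al j)) != 0 ->
  exists2 x, nz_rows x & forall j, (j < m)%N -> F j x = 0.
Proof.
move=> d0 ad coef.
have cells p : exists v : cell n d p.+1, forall j, (j < m)%N -> exists u u',
    [/\ near_cell m u v, near_cell m u' v &
     sign_bit j (sphere_map (grid_point u)) != sign_bit j (sphere_map (grid_point u'))].
  pose s j (v : cell n d p.+1) := sign_bit j (sphere_map (grid_point v)).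
  have s_tau j (i : 'I_n * 'I_d) (u : cell n d p.+1) : (0 < i.2)%N -> u i = ord0 ->
      s j (tau i u) = s j u + al j i.1.
    case: i => b i /= i0 ui; rewrite /s sphere_map_tau// sign_bit_neg//.
    exact: nz_rows_sphere_map.
  move: coef; rewrite -(total_cup_mcoeff _ s_tau)// => tot.
  have /existsP[v v0] : [exists v, cup s m v != 0].
    apply: contraNT tot => /existsPn H; apply/eqP/big1 => v _.
    by apply/eqP; rewrite -[_ == _]negbK H.
  by exists v; exact: cup_neq0.
pose v p := sval (cid (cells p)); have vP p := svalP (cid (cells p)).
pose w p := grid_point (v p).
pose K := [set z : 'rV[R]_(n * d) | forall l, `[-1, 1]%classic (z ord0 l)].
have Kc : compact K by apply: (rV_compact (fun=> @segment_compact R (-1) 1)).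
have wK p : K (w p).
  move=> l; case/mxvec_indexP: l => b i; rewrite /= in_itv /= mxvecE mxE.
  have p2 : 0 < (2 * p.+1)%:R :> R by rewrite ltr0n.
  rewrite lerBrDr addNr divr_ge0 ?ler0n//= lerBlDr ler_pdivrMr//.
  by rewrite -[1 + 1]/(2%:R) -natrM ler_nat; have := ltn_ord (v p (b, i)); lia.
have [z [Kz clz]] := Kc (w p @[p --> \oo]) _ (filterE _ wK).
exists (sphere_map z); first exact: nz_rows_sphere_map.
move=> j jm; apply/eqP/negP => /negP Fz.
have cF : F j (sphere_map y) @[y --> z] --> F j (sphere_map z).
  apply: (@cvg_comp _ _ _ sphere_map (F j) _ _ _ (@sphere_map_continuous z)).
  exact/F_cont/nz_rows_sphere_map.
(* Multiplying by the value at [z] treats both of its possible signs at once. *)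
have Fz2 : 0 < F j (sphere_map z) * F j (sphere_map z).
  by rewrite -expr2 exprn_even_gt0//= Fz.
have [e /= e0 He] := (nbhs_ballP _ _).1
  (cvgr_gt _ (@cvgMl_tmp _ _ _ _ _ (F j (sphere_map z)) _ cF) _ Fz2).
(* From [p0] on, [m] grid steps cover less than [e / 2]; the other half is the distance from the
   cell to [z]. *)
have [p0 p0P] : exists p0 : nat, forall p, (p0 <= p)%N -> m%:R / (2 * p.+1)%:R < e / 2.
  exists (Num.truncn (m%:R / e)) => p pp.
  rewrite natrM invfM mulrA mulrAC ltr_pM2r ?invr_gt0//.
  rewrite ltr_pdivrMr ?ltr0n// mulrC -ltr_pdivrMr//.
  by rewrite (lt_le_trans (truncnS_gt _))// ler_nat.
have [_ [[q /= pp <-] zp]] := clz [set w p | p in [set p | (p0 <= p)%N]] (ball z (e / 2))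
  (ex_intro2 _ _ p0 I (fun p pp => ex_intro2 _ _ p pp erefl))
  (nbhsx_ballx z (e / 2) ltac:(by rewrite divr_gt0)).
have near_ball u : near_cell m u (v q) -> ball z e (grid_point u).
  move=> uv; rewrite [e]splitr; apply: (ball_triangle zp); split; first by rewrite divr_gt0.
  move=> i l; rewrite (ord1 i) /ball /= distrC.
  by rewrite (le_lt_trans (grid_point_near _ _ uv))// p0P.
have [u [u' [uv uv' /sign_bit_neq[pos neg]]]] := vP q j jm.
have := He _ (near_ball _ uv'); have := He _ (near_ball _ uv).
rewrite /=; case: (ltgtP 0 (F j (sphere_map z))) Fz => // Fz _.
  by rewrite !pmulr_rgt0// => ? ?; apply: pos.
by rewrite !nmulr_rgt0// => ? ?; apply: neg.
Qed.

End signs.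
End borsuk_ulam.

(** * Hyperplanes and half-spaces *)

Section null_hyperplane.
Variable R : realType.
Local Open Scope ereal_scope.

(** Induction on the dimension: if a later coefficient is nonzero, every section over the first
    coordinate is a null hyperplane; otherwise the first coordinate is confined to a point. *)
Lemma lebesgue_tuple_hyperplane n (u : 'I_n -> R) (c : R) : (exists i, u i != 0%R) ->
  lebesgue_tuple R n [set t | (\sum_(i < n) u i * tnth t i)%R = c] = 0.
Proof.
elim: n u c => [|n IH] u c [i0 ui0]; first by case: i0 ui0.
rewrite /= /tcons_measure /pushforward.
have sumE x (t : n.-tuple R) : (\sum_(i < n.+1) u i * tnth [tuple of x :: t] i =
    u ord0 * x + \sum_(i < n) u (lift ord0 i) * tnth t i)%R.
  rewrite big_ord_recl tnth0; congr (_ + _)%R.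
  by apply: eq_bigr => i _; rewrite tnthS.
have [[j uj]|/forallNP u0] := pselect (exists j, u (lift ord0 j) != 0%R).
  apply: integral0_eq => x _ /=.
  rewrite -[RHS](IH (fun i => u (lift ord0 i)) (c - u ord0 * x)%R); last by exists j.
  congr (lebesgue_tuple R n _); rewrite xsectionE; apply/seteqP.
  split => t /=; rewrite sumE.
    by move=> <-; rewrite addrAC subrr add0r.
  by move=> ->; rewrite addrC subrK.
have {}u0 j : u (lift ord0 j) = 0%R by apply/eqP/negPn/negP/u0.
have u00 : u ord0 != 0%R by case: (unliftP ord0 i0) ui0 => [j|] ->; rewrite ?u0 ?eqxx.
rewrite (_ : _ @^-1` _ = [set (c / u ord0)%R] `*` setT); last first.
  have sum0 (t : n.-tuple R) : (\sum_(i < n) u (lift ord0 i) * tnth t i = 0)%R.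
    by apply: big1 => i _; rewrite u0 mul0r.
  apply/seteqP; split => -[x t] /=; rewrite sumE sum0 addr0.
    by move=> <-; split => //; rewrite mulrC mulKf.
  by move=> [-> _]; rewrite mulrC divfK.
by rewrite product_measure1E// [X in X * _](lebesgue_measure_set1) mul0e.
Qed.

Lemma lebesgue_euclid_hyperplane d (u : 'rV[R]_d) (c : R) : u != 0%R ->
  @lebesgue_euclid R d [set x | dotv u x = c] = 0.
Proof.
move=> u0; rewrite /lebesgue_euclid /pushforward.
rewrite -[RHS](@lebesgue_tuple_hyperplane d (fun i => u ord0 i) c); last first.
  apply: contrapT => /forallNP H; case/eqP: u0; apply/rowP => i; rewrite mxE.
  exact/eqP/negPn/negP/H.
congr (lebesgue_tuple R d _); apply/seteqP.
have E (t : d.-tuple R) : (\sum_(i < d) u ord0 i * tnth t i)%R = dotv u (\row_i tnth t i).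
  by apply: eq_bigr => i _; rewrite mxE.
by split => t /=; rewrite E.
Qed.

End null_hyperplane.

Section dotv.
Variables (R : realType) (d : nat).
Implicit Types (u v x y : 'rV[R]_d) (c t : R).

Lemma dotvDr u x y : dotv u (x + y) = dotv u x + dotv u y.
Proof. by rewrite /dotv -big_split; apply: eq_bigr => i _; rewrite mxE mulrDr. Qed.

Lemma dotvDl u v x : dotv (u + v) x = dotv u x + dotv v x.
Proof. by rewrite /dotv -big_split; apply: eq_bigr => i _; rewrite mxE mulrDl. Qed.

Lemma dotvZr u x t : dotv u (t *: x) = t * dotv u x.
Proof. by rewrite /dotv mulr_sumr; apply: eq_bigr => i _; rewrite mxE mulrCA. Qed.

Lemma dotvZl u x t : dotv (t *: u) x = t * dotv u x.
Proof. by rewrite /dotv mulr_sumr; apply: eq_bigr => i _; rewrite mxE mulrA. Qed.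

Lemma dotvNl u x : dotv (- u) x = - dotv u x.
Proof. by rewrite -scaleN1r dotvZl mulN1r. Qed.

Lemma dotv_continuous u : continuous (dotv u).
Proof.
move=> x; rewrite /continuous_at /dotv.
apply: (@cvg_big _ _ _ _ _ _ _ (nbhs x) _ _ _ (nbhs_filter x)) => [|i _].
  exact: add_continuous.
by apply: cvgMl_tmp; exact: coord_continuous.
Qed.

Definition hs u c (s : bool) : set 'rV[R]_d :=
  if s then [set x | c <= dotv u x] else [set x | dotv u x <= c].

Definition ohs u c (s : bool) : set 'rV[R]_d :=
  if s then [set x | c < dotv u x] else [set x | dotv u x < c].

Lemma hsN u c s : hs (- u) (- c) s = hs u c (~~ s).
Proof. by case: s; apply/seteqP; split => x /=; rewrite dotvNl lerN2. Qed.

Lemma hs_closed u c s : closed (hs u c s).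
Proof.
have cu : continuous (dotv u) := @dotv_continuous u.
case: s; [rewrite -[hs _ _ _]/(dotv u @^-1` [set y | c <= y])
         |rewrite -[hs _ _ _]/(dotv u @^-1` [set y | y <= c])];
  apply: closed_comp => //.
Qed.

Lemma ohs_open u c s : open (ohs u c s).
Proof.
have cu : continuous (dotv u) := @dotv_continuous u.
case: s; [rewrite -[ohs _ _ _]/(dotv u @^-1` [set y | c < y])
         |rewrite -[ohs _ _ _]/(dotv u @^-1` [set y | y < c])];
  apply: open_comp => //.
Qed.

(** This is convexity. *)
Definition segment_closed (A : set 'rV[R]_d) := forall x y t,
  A x -> A y -> 0 <= t <= 1 -> A ((1 - t) *: x + t *: y).

Lemma segment_closed_ohs u c s : segment_closed (ohs u c s).
Proof.
have gt (a b t : R) : c < a -> c < b -> 0 <= t <= 1 -> c < (1 - t) * a + t * b.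
  by move=> ca cb /andP[t0 t1]; case: (leP a b) => ab; nra.
have lt (a b t : R) : a < c -> b < c -> 0 <= t <= 1 -> (1 - t) * a + t * b < c.
  by move=> ca cb /andP[t0 t1]; case: (leP a b) => ab; nra.
by move=> x y t; case: s; rewrite /ohs /= dotvDr !dotvZr; [exact: gt|exact: lt].
Qed.

Lemma segment_closed_dotv (A : set 'rV[R]_d) u c x y : segment_closed A ->
  A x -> A y -> dotv u x <= c <= dotv u y -> exists2 z, A z & dotv u z = c.
Proof.
move=> Ac Ax Ay /andP[xc cy]; have [xy|xy] := eqVneq (dotv u x) (dotv u y).
  by exists x => //; apply/eqP; rewrite eq_le xc xy cy.
have xy0 : 0 < dotv u y - dotv u x by rewrite subr_gt0 lt_neqAle xy (le_trans xc).
exists ((1 - (c - dotv u x) / (dotv u y - dotv u x)) *: x +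
  ((c - dotv u x) / (dotv u y - dotv u x)) *: y).
  apply: Ac => //; rewrite divr_ge0 ?(ltW xy0) ?subr_ge0//=.
  by rewrite ler_pdivrMr// mul1r lerD2r.
by rewrite dotvDr !dotvZr; field; rewrite gt_eqF.
Qed.

End dotv.

Lemma cvg_sumr (R : realType) (T I : Type) (F : set_system T) {FF : Filter F}
    (r : seq I) (f : I -> T -> R) (l : I -> R) :
  (forall i, f i p @[p --> F] --> l i) ->
  (\sum_(i <- r) f i p) @[p --> F] --> \sum_(i <- r) l i.
Proof.
move=> fl; elim: r => [|i r IH].
  by rewrite big_nil; under eq_cvg do rewrite big_nil; exact: cvg_cst.
by rewrite big_cons; under eq_cvg do rewrite big_cons; exact: cvgD.
Qed.

(** * Masses as real numbers, and continuity of half-spaces in measure *)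

Section mass.
Variables (R : realType) (d : nat) (mu : {finite_measure set (euclid R d) -> \bar R}).
Local Notation msb := (@measurable _ (euclid R d)).
Implicit Types (A B : set 'rV[R]_d) (u : 'rV[R]_d) (c : R).

Definition fmass A : R := fine (mu A).
Local Notation m := fmass.

Lemma euclid_open A : open A -> msb A.
Proof. exact: sub_sigma_algebra. Qed.

Lemma euclid_closed A : closed A -> msb A.
Proof.
by move=> Ac; rewrite -[A]setCK; apply: measurableC; apply: euclid_open; exact: closed_openC.
Qed.

Lemma msb_hs u c s : msb (hs u c s).
Proof. exact: euclid_closed (@hs_closed _ _ u c s). Qed.

Lemma massE A : msb A -> mu A = (m A)%:E.
Proof. by move=> mA; rewrite fineK// fin_num_measure. Qed.

Lemma mass_ge0 A : 0 <= m A.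
Proof. exact/fine_ge0/measure_ge0. Qed.

Lemma le_mass A B : msb A -> msb B -> A `<=` B -> m A <= m B.
Proof.
by move=> mA mB AB; rewrite -lee_fin -!massE//; apply: le_measure; rewrite ?inE.
Qed.

Lemma massDI A B : msb A -> msb B -> m A = m (A `\` B) + m (A `&` B).
Proof.
move=> mA mB; apply: EFin_inj; rewrite EFinD -!massE//.
- exact: measureDI.
- exact: measurableI.
- exact: measurableD.
Qed.

Lemma massU2 A B : msb A -> msb B -> m (A `|` B) <= m A + m B.
Proof.
move=> mA mB; rewrite -lee_fin EFinD -!massE//; first exact: measureU2.
exact: measurableU.
Qed.

Lemma mass0 : m set0 = 0.
Proof. by rewrite /m measure0. Qed.

Lemma mass_null A B : msb A -> msb B -> A `<=` B -> m B = 0 -> m A = 0.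
Proof. by move=> mA mB AB B0; apply/eqP; rewrite eq_le mass_ge0 -B0 le_mass. Qed.

(** The measure pseudometric on sets. By [sdI] and [sd_all], continuity of boxes reduces to
    continuity of half-spaces. *)
Definition sd A B := m (A `+` B).

Lemma msb_setY A B : msb A -> msb B -> msb (A `+` B).
Proof. by move=> mA mB; apply: measurableU; apply: measurableD. Qed.

Lemma sd_mass A B : msb A -> msb B -> `|m A - m B| <= sd A B.
Proof.
move=> mA mB; rewrite (massDI mA mB) (massDI mB mA) [B `&` A]setIC opprD addrACA subrr addr0.
have : m (A `\` B) <= sd A B.
  by apply: le_mass => //; [exact: measurableD|exact: msb_setY|left].
have : m (B `\` A) <= sd A B.
  by apply: le_mass => //; [exact: measurableD|exact: msb_setY|right].
have := mass_ge0 (A `\` B); have := mass_ge0 (B `\` A).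
by move=> *; rewrite ler_norml; apply/andP; split; lra.
Qed.

Lemma sd_ge0 A B : 0 <= sd A B. Proof. exact: mass_ge0. Qed.

Lemma sdI A B A' B' : msb A -> msb B -> msb A' -> msb B' ->
  sd (A `&` B) (A' `&` B') <= sd A A' + sd B B'.
Proof.
move=> mA mB mA' mB'; apply: le_trans (massU2 _ _); try exact: msb_setY.
apply: le_mass; first by apply: msb_setY; exact: measurableI.
  by apply: measurableU; exact: msb_setY.
move=> x /= [[[Ax Bx] /not_andP[]]|[[Ax Bx] /not_andP[]]] H;
  [left; left|right; left|left; right|right; right] => //.
Qed.

Lemma msb_all l (S : 'I_l -> set 'rV[R]_d) :
  (forall j, msb (S j)) -> msb [set x | forall j, S j x].
Proof.
move=> mS; rewrite (_ : mkset _ = \bigcap_(j in [set: 'I_l]) S j).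
  exact: fin_bigcap_measurable.
by apply/seteqP; split => x /= H j //; apply: H.
Qed.

Lemma mass_big_le l (S : 'I_l -> set 'rV[R]_d) A : msb A -> (forall j, msb (S j)) ->
  (forall x, A x -> exists j, S j x) -> m A <= \sum_j m (S j).
Proof.
move=> mA mS AS.
have [mU leU] : msb (\big[setU/set0]_j S j) /\ m (\big[setU/set0]_j S j) <= \sum_j m (S j).
  apply: (@big_ind2 _ _ (fun (B : set 'rV[R]_d) (r : R) => msb B /\ m B <= r)).
  - by rewrite mass0.
  - move=> B r B' r' [mB Br] [mB' Br']; split; first exact: measurableU.
    by apply: le_trans (massU2 mB mB') _; exact: lerD.
  - by move=> j _; split.
apply: le_trans leU; apply: le_mass => // x /AS[j Sjx].
by rewrite (bigD1 j)//=; left.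
Qed.

Lemma sd_all l (S S' : 'I_l -> set 'rV[R]_d) :
  (forall j, msb (S j)) -> (forall j, msb (S' j)) ->
  sd [set x | forall j, S j x] [set x | forall j, S' j x] <= \sum_j sd (S j) (S' j).
Proof.
move=> mS mS'; apply: mass_big_le.
- by apply: msb_setY; exact: msb_all.
- by move=> j; exact: msb_setY.
- by move=> x /= [[H /existsNP[j Sj]]|[H /existsNP[j Sj]]]; exists j; [left|right].
Qed.

Section convergence.
Variables (T : Type) (F : set_system T).
Context {FF : Filter F}.

Lemma sd_cvg_mass (S : T -> set 'rV[R]_d) S0 : (forall p, msb (S p)) -> msb S0 ->
  sd (S p) S0 @[p --> F] --> (0 : R) -> m (S p) @[p --> F] --> m S0.
Proof.
move=> mS mS0 S_S0; apply/cvgrPdist_le => e e0.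
near=> p; rewrite distrC; apply: le_trans (sd_mass (mS p) mS0) _.
by near: p; exact: cvgr_le _ S_S0 _ e0.
Unshelve. all: by end_near. Qed.

Lemma sd_cvgI (A B : T -> set 'rV[R]_d) A0 B0 :
  (forall p, msb (A p)) -> (forall p, msb (B p)) -> msb A0 -> msb B0 ->
  sd (A p) A0 @[p --> F] --> (0 : R) -> sd (B p) B0 @[p --> F] --> (0 : R) ->
  sd (A p `&` B p) (A0 `&` B0) @[p --> F] --> (0 : R).
Proof.
move=> mA mB mA0 mB0 cA cB.
apply: (@squeeze_cvgr _ _ FF _ (fun=> 0) (fun p => sd (A p) A0 + sd (B p) B0) _).
- by near=> p; rewrite sd_ge0 sdI.
- exact: cvg_cst.
- by rewrite -[X in _ --> X]addr0; exact: cvgD.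
Unshelve. all: by end_near. Qed.

Lemma sd_cvg_all l (S : T -> 'I_l -> set 'rV[R]_d) S0 :
  (forall p j, msb (S p j)) -> (forall j, msb (S0 j)) ->
  (forall j, sd (S p j) (S0 j) @[p --> F] --> (0 : R)) ->
  sd [set x | forall j, S p j x] [set x | forall j, S0 j x] @[p --> F] --> (0 : R).
Proof.
move=> mS mS0 cS.
apply: (@squeeze_cvgr _ _ FF _ (fun=> 0) (fun p => \sum_j sd (S p j) (S0 j)) _).
- by near=> p; rewrite sd_ge0 sd_all.
- exact: cvg_cst.
- rewrite [X in _ --> X](_ : _ = \sum_(j < l) (0 : R)); last by rewrite big1.
  exact: cvg_sumr.
Unshelve. all: by end_near. Qed.

Hypothesis mass_plane : forall u c, u != 0 -> m [set x | dotv u x = c] = 0.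

(** Points on which nearby half-spaces disagree lie in a thin set [Y k] around the limit hyperplane;
    these sets decrease to that null hyperplane. *)
Lemma sd_cvg_hs (u : T -> 'rV[R]_d) (c : T -> R) u0 c0 s : u0 != 0 ->
  u p @[p --> F] --> u0 -> c p @[p --> F] --> c0 ->
  sd (hs (u p) (c p) s) (hs u0 c0 s) @[p --> F] --> (0 : R).
Proof.
move=> u0_neq0 uF cF.
pose g (x : 'rV[R]_d) : R := \sum_i `|x ord0 i|.
have g_cont : continuous (g : 'rV[R]_d -> R).
  move=> x; apply: (@cvg_sumr _ _ _ (nbhs x) (nbhs_filter x)) => i.
  by apply: cvg_norm; exact: coord_continuous.
(* The width grows with [g x], because tilting the normal moves [dotv] by an amount proportional to
   the size of [x]. *)
pose Y k := [set x : 'rV[R]_d | `|dotv u0 x - c0| <= (1 + g x) / k.+1%:R].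
have mY k : msb (Y k).
  apply: euclid_closed.
  rewrite (_ : Y k = (fun x => (1 + g x) / k.+1%:R - `|dotv u0 x - c0|) @^-1` [set y | 0 <= y]).
    apply: closed_comp; last exact: closed_ge.
    move=> x _; apply: (@cvgB _ _ _ (nbhs x) (nbhs_filter x)).
      apply: cvgMr_tmp; apply: cvgD; first exact: cvg_cst.
      exact: g_cont.
    apply: cvg_norm; apply: cvgB; last exact: cvg_cst.
    exact: dotv_continuous.
  by apply/seteqP; split => x /=; rewrite subr_ge0.
have gx0 x : 0 <= g x by apply: sumr_ge0 => i _; exact: normr_ge0.
have Ycap : \bigcap_k Y k = [set x | dotv u0 x = c0].
  apply/seteqP; split => [x Yx|x /= xc k _]; last first.
    by rewrite /Y /= xc subrr normr0 divr_ge0// addr_ge0.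
  apply/eqP; rewrite -subr_eq0 -normr_eq0; apply/negPn/negP => xc.
  have xc0 : 0 < `|dotv u0 x - c0| by rewrite lt_neqAle eq_sym xc normr_ge0.
  have := Yx (Num.truncn ((1 + g x) / `|dotv u0 x - c0|)) I; rewrite /Y /= leNgt.
  rewrite ltr_pdivrMr ?ltr0n// mulrC -ltr_pdivrMr//.
  by rewrite truncnS_gt.
have Y0 : m (Y k) @[k --> \oo] --> (0 : R).
  rewrite -(mass_plane c0 u0_neq0) -Ycap.
  have mcap : msb (\bigcap_k Y k) by exact: bigcapT_measurable.
  apply: fine_cvg.
  rewrite -massE//; apply: nonincreasing_cvg_mu => //.
    by rewrite -ge0_fin_numE// fin_num_measure.
  move=> k k' kk'; apply/subsetPset => x; rewrite /Y /= => /le_trans; apply.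
  by rewrite ler_wpM2l ?addr_ge0// lef_pV2 ?posrE ?ltr0n// ler_nat.
apply/cvgrPdist_lt => e e0.
have [k Yk] : exists k, m (Y k) < e.
  have [k _ Yk] := cvgr_lt _ Y0 _ e0.
  by exists k; apply: Yk => /=.
have k0 : 0 < k.+1%:R^-1 :> R by rewrite invr_gt0.
near=> p.
have [_ up] : ball u0 k.+1%:R^-1 (u p) by near: p; apply: uF; exact: nbhsx_ballx.
have cp : `|c0 - c p| < k.+1%:R^-1 by near: p; move/cvgrPdist_lt : cF; exact.
rewrite sub0r normrN ger0_norm ?sd_ge0//; apply: le_lt_trans Yk.
apply: le_mass => //; first by apply: msb_setY; exact: msb_hs.
move=> x H; rewrite /Y /=.
have close : `|(dotv u0 x - c0) - (dotv (u p) x - c p)| <= (1 + g x) / k.+1%:R.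
  have -> : dotv u0 x - c0 - (dotv (u p) x - c p) = dotv (u0 - u p) x - (c0 - c p).
    by rewrite dotvDl dotvNl; ring.
  apply: le_trans (ler_normB _ _) _.
  rewrite mulrDl mul1r [leRHS]addrC lerD ?(ltW cp)//.
  rewrite /dotv mulr_suml; apply: le_trans (ler_norm_sum _ _ _) _.
  apply: ler_sum => i _; rewrite normrM mulrC ler_wpM2l// !mxE.
  by have := up ord0 i; rewrite /ball /= => /ltW.
move: close; rewrite !ler_norml; move: (_ / _) => B /andP[].
move: H; case: s => /= -[[]|[]] h /negP; rewrite -ltNge => h' h1 h2; apply/andP; split; lra.
Unshelve. all: by end_near. Qed.

End convergence.
End mass.

(** * Quantile hyperplanes *)

Section quantiles.
Variables (R : realType) (d : nat) (mu : {finite_measure set (euclid R d) -> \bar R}).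
Local Notation msb := (@measurable _ (euclid R d)).
Local Notation m := (fmass mu).
Implicit Types (A : set 'rV[R]_d) (u : 'rV[R]_d) (c q : R).

Hypothesis mass_plane : forall u c, u != 0 -> m [set x | dotv u x = c] = 0.
Hypothesis mass_open : forall U : set 'rV[R]_d, open U -> U !=set0 -> 0 < m U.

(** Up to a null set [A] is open and convex. This excludes gaps in the mass along a direction and
    makes quantiles unique. *)
Definition convex_interior A := exists D : set 'rV[R]_d,
  [/\ open D, segment_closed D, D `<=` A & m (A `\` D) = 0].

Definition cdf A u c := m (A `&` hs u c false).

Lemma msbI_hs A u c s : msb A -> msb (A `&` hs u c s).
Proof. by move=> mA; apply: measurableI => //; exact: msb_hs. Qed.
Local Hint Resolve msbI_hs : core.

Lemma mass_hs_split A u c : msb A -> u != 0 ->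
  m A = m (A `&` hs u c false) + m (A `&` hs u c true).
Proof.
move=> mA u0; rewrite (massDI mu mA (msb_hs u c false)) addrC; congr (_ + _).
rewrite (massDI mu (msbI_hs u c true mA) (msb_hs u c false)).
rewrite [X in _ = _ + X](mass_null _ _ _ (mass_plane c u0)) ?addr0.
- congr (m _); apply/seteqP; split => x /=; last by case=> -[].
  by case=> Ax h; split=> //; split => //; move/negP: h; rewrite -ltNge => /ltW.
- exact: msbI_hs (msbI_hs _ _ _ mA).
- rewrite (_ : mkset _ = hs u c true `&` hs u c false).
    by apply: measurableI; exact: msb_hs.
  by apply/seteqP; split => x /=; [move=> ->|case=> ? ?; apply/eqP; rewrite eq_le; apply/andP].
- by move=> x /= [[_ h1] h2]; apply/eqP; rewrite eq_le h1 h2.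
Qed.

Lemma cdfN A u c : msb A -> u != 0 -> cdf A (- u) (- c) = m A - cdf A u c.
Proof. by move=> mA u0; rewrite /cdf hsN (mass_hs_split c mA u0) /=; ring. Qed.

Lemma cdf_mono A u c c' : msb A -> c <= c' -> cdf A u c <= cdf A u c'.
Proof.
move=> mA cc'; apply: le_mass; [exact: msbI_hs|exact: msbI_hs|].
by move=> x [Ax /= h]; split => //=; exact: le_trans cc'.
Qed.

(** The convex set [D] has points on both sides of the strip, hence one inside; its part in the open
    strip is open and nonempty, so of positive mass. *)
Lemma cdf_lt A u c c' : msb A -> convex_interior A -> u != 0 -> c < c' ->
  0 < cdf A u c -> cdf A u c' < m A -> cdf A u c < cdf A u c'.
Proof.
move=> mA [D [Oo Oc OA AO]] u0 cc' cA c'A.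
have mO := euclid_open Oo.
have [x Ox xc] : exists2 x, D x & dotv u x <= c.
  apply: contrapT => H; suff cA0 : cdf A u c = 0 by rewrite cA0 ltxx in cA.
  apply: (mass_null _ _ _ AO) => //; [exact: msbI_hs|exact: measurableD|].
  by move=> x [Ax h]; split => // Ox; apply: H; exists x.
have [y Oy yc] : exists2 y, D y & c' <= dotv u y.
  apply: contrapT => H; move: c'A; rewrite (mass_hs_split c' mA u0) /cdf ltrDl.
  suff -> : m (A `&` hs u c' true) = 0 by rewrite ltxx.
  apply: (mass_null _ _ _ AO) => //; [exact: msbI_hs|exact: measurableD|].
  by move=> z [Az h]; split => // Oz; apply: H; exists z.
have [z Oz zc] : exists2 z, D z & dotv u z = (c + c') / 2.
  by apply: (segment_closed_dotv Oc Ox Oy); apply/andP; split; lra.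
pose V := D `&` (ohs u c true `&` ohs u c' false).
have Vo : open V by apply: openI => //; apply: openI; exact: ohs_open.
have V0 : 0 < m V.
  by apply: mass_open => //; exists z; split => //; split; rewrite /= zc; lra.
have VA : V `<=` (A `&` hs u c' false) `\` hs u c false.
  move=> w [Ow [/= h1 h2]]; split; first by split; [exact: OA|exact: ltW].
  by apply/negP; rewrite -ltNge.
rewrite /cdf (massDI mu (msbI_hs u c' false mA) (msb_hs u c false)).
have -> : A `&` hs u c' false `&` hs u c false = A `&` hs u c false.
  apply/seteqP; split => w; first by case=> -[].
  by case=> Aw wc; split => //; split => //; exact: le_trans wc (ltW cc').
rewrite ltrDr (lt_le_trans V0)//; apply: le_mass => //.
  exact: euclid_open.
by apply: measurableD; [exact: msbI_hs|exact: msb_hs].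
Qed.

Lemma cdf_cvg (T : Type) (F : set_system T) {FF : Filter F}
    (A : T -> set 'rV[R]_d) (u : T -> 'rV[R]_d) (c : T -> R) A0 u0 c0 :
  (forall p, msb (A p)) -> msb A0 -> u0 != 0 ->
  sd mu (A p) A0 @[p --> F] --> (0 : R) -> u p @[p --> F] --> u0 ->
  c p @[p --> F] --> c0 -> cdf (A p) (u p) (c p) @[p --> F] --> cdf A0 u0 c0.
Proof.
move=> mA mA0 u0_neq0 AF uF cF; apply: sd_cvg_mass; try by move=> *; exact: msbI_hs.
apply: sd_cvgI => //; try by move=> *; exact: msb_hs.
exact: sd_cvg_hs.
Qed.

Lemma sdxx A : sd mu A A = 0.
Proof. by rewrite /sd setYK mass0. Qed.

Lemma cdf_small A u e : msb A -> u != 0 -> 0 < e -> exists c, cdf A u c < e.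
Proof.
move=> mA u0 e0; pose B k := A `&` hs u (- k%:R) false.
have mB k : msb (B k) by exact: msbI_hs.
have B0 : m (B k) @[k --> \oo] --> (0 : R).
  have capB : \bigcap_k B k = set0.
    apply/seteqP; split => // x Bx; have [_ /=] := Bx (Num.truncn (- dotv u x)).+1 I.
    by rewrite lerNr leNgt truncnS_gt.
  rewrite -(mass0 mu) -capB; have mcap : msb (\bigcap_k B k) by exact: bigcapT_measurable.
  apply: fine_cvg; rewrite -massE//; apply: nonincreasing_cvg_mu => //.
    by rewrite -ge0_fin_numE// fin_num_measure.
  move=> k k' kk'; apply/subsetPset => x [Ax /= h]; split => //=.
  by rewrite (le_trans h)// lerN2 ler_nat.
have [k _ Bk] := cvgr_lt _ B0 _ e0.
by exists (- k%:R); apply: (Bk k) => /=.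
Qed.

Lemma quantile_exists A u q : msb A -> u != 0 -> 0 < m A -> 0 < q < 1 ->
  exists c, cdf A u c = q * m A.
Proof.
move=> mA u0 A0 /andP[q0 q1].
have [a qa] : exists a, cdf A u a < q * m A by apply: cdf_small => //; exact: mulr_gt0.
(* The upper bound is the lower one for the opposite direction, through [cdfN]. *)
have [b qb] : exists b, q * m A < cdf A u b.
  have [||b bq] := @cdf_small A (- u) ((1 - q) * m A) mA.
  - by rewrite oppr_eq0.
  - by rewrite mulr_gt0 ?subr_gt0.
  exists (- b); move: bq; rewrite -[b]opprK cdfN// opprK; lra.
have ab : a <= b.
  by rewrite leNgt; apply/negP => /ltW /(cdf_mono u mA); lra.
have [||c _ cq] := @IVT R (cdf A u) a b (q * m A) ab.
- apply: continuous_subspaceT => c; apply: (@cdf_cvg _ (nbhs c)) => //.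
  + by under eq_fun do rewrite sdxx; exact: cvg_cst.
  + exact: cvg_cst.
- by rewrite minEle maxEle (ltW (lt_trans qa qb)) !ltW.
- by exists c.
Qed.

(** The default 0 is a filler for when no offset has the required level, which [quantile_exists]
    excludes in the cases of interest. *)
Definition quantile A u q : R := xget 0 [set c | cdf A u c = q * m A].

Lemma quantileP A u q : msb A -> u != 0 -> 0 < m A -> 0 < q < 1 ->
  cdf A u (quantile A u q) = q * m A.
Proof.
move=> mA u0 A0 q01; have [c cq] := quantile_exists mA u0 A0 q01.
by rewrite /quantile; case: xgetP => [_ _ //|/(_ c)].
Qed.

Lemma quantile_between A u q c : msb A -> convex_interior A -> u != 0 ->
  0 < m A -> 0 < q < 1 ->
  (c < quantile A u q -> cdf A u c < q * m A) /\
  (quantile A u q < c -> q * m A < cdf A u c).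
Proof.
move=> mA Ac u0 A0 q01; have qP := quantileP mA u0 A0 q01.
have /andP[q0 q1] := q01.
have qA : q * m A < m A by rewrite gtr_pMl.
have qA0 : 0 < q * m A by exact: mulr_gt0.
split => cq; rewrite -qP.
  have [c0|c0] := leP (cdf A u c) 0; first by rewrite (le_lt_trans c0) ?qP.
  by apply: cdf_lt => //; rewrite qP.
have [c1|c1] := leP (m A) (cdf A u c); first by rewrite (lt_le_trans _ c1) ?qP.
by apply: cdf_lt => //; rewrite qP.
Qed.

Lemma quantile_unique A u q c : msb A -> convex_interior A -> u != 0 ->
  0 < m A -> 0 < q < 1 -> cdf A u c = q * m A -> c = quantile A u q.
Proof.
move=> mA Ac u0 A0 q01 cq; have [lo hi] := quantile_between c mA Ac u0 A0 q01.
apply/eqP; rewrite eq_le !leNgt; apply/andP; split; apply/negP.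
  by move=> /hi; rewrite cq ltxx.
by move=> /lo; rewrite cq ltxx.
Qed.

Lemma quantileN A u q : msb A -> convex_interior A -> u != 0 ->
  0 < m A -> 0 < q < 1 -> quantile A (- u) (1 - q) = - quantile A u q.
Proof.
move=> mA Ac u0 A0 q01; have /andP[q0 q1] := q01; apply/esym/quantile_unique => //.
- by rewrite oppr_eq0.
- by apply/andP; split; lra.
- by rewrite cdfN// quantileP//; ring.
Qed.

(** At [c0 - e] and [c0 + e] the limit distribution is strictly below and above the level. Both
    inequalities persist nearby, and monotonicity traps the nearby quantile. *)
Lemma quantile_cvg (T : Type) (F : set_system T) {FF : Filter F}
    (A : T -> set 'rV[R]_d) (u : T -> 'rV[R]_d) A0 u0 q :
  (forall p, msb (A p)) -> msb A0 -> convex_interior A0 -> u0 != 0 -> 0 < m A0 ->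
  0 < q < 1 -> (\forall p \near F, u p != 0) -> 
  sd mu (A p) A0 @[p --> F] --> (0 : R) -> u p @[p --> F] --> u0 ->
  quantile (A p) (u p) q @[p --> F] --> quantile A0 u0 q.
Proof.
move=> mA mA0 Ac u0_neq0 A0_gt0 q01 u_neq0 AF uF.
have mF : m (A p) @[p --> F] --> m A0 by exact: sd_cvg_mass.
have posF : \forall p \near F, 0 < m (A p) := cvgr_gt _ mF _ A0_gt0.
apply/cvgrPdist_lt => e e0; set c0 := quantile A0 u0 q.
have [lo _] := quantile_between (c0 - e) mA0 Ac u0_neq0 A0_gt0 q01.
have [_ hi] := quantile_between (c0 + e) mA0 Ac u0_neq0 A0_gt0 q01.
have diff c : cdf (A p) (u p) c - q * m (A p) @[p --> F] -->
    cdf A0 u0 c - q * m A0.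
  apply: cvgB; last exact: cvgMl_tmp.
  by apply: cdf_cvg => //; exact: cvg_cst.
have loF : \forall p \near F, cdf (A p) (u p) (c0 - e) - q * m (A p) < 0.
  by apply: (cvgr_lt _ (diff _)); rewrite subr_lt0 lo// ltrBlDr ltrDl.
have hiF : \forall p \near F, 0 < cdf (A p) (u p) (c0 + e) - q * m (A p).
  by apply: (cvgr_gt _ (diff _)); rewrite subr_gt0 hi// ltrDl.
near=> p.
have qp : cdf (A p) (u p) (quantile (A p) (u p) q) = q * m (A p).
  have up : u p != 0 by near: p; exact: u_neq0.
  have mp : 0 < m (A p) by near: p; exact: posF.
  exact: quantileP.
have lop : cdf (A p) (u p) (c0 - e) - q * m (A p) < 0 by near: p; exact: loF.
have hip : 0 < cdf (A p) (u p) (c0 + e) - q * m (A p) by near: p; exact: hiF.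
rewrite ltr_distlC; apply/andP; split; rewrite ltNge; apply/negP => H.
  by have := cdf_mono (u p) (mA p) H; rewrite qp; lra.
by have := cdf_mono (u p) (mA p) H; rewrite qp; lra.
Unshelve. all: by end_near. Qed.

End quantiles.

(** * Boxes *)

Section boxes.
Variables (R : realType) (d : nat) (mu : {finite_measure set (euclid R d) -> \bar R}).
Local Notation msb := (@measurable _ (euclid R d)).
Local Notation m := (fmass mu).
Implicit Types (A : set 'rV[R]_d) (u : 'rV[R]_d) (c q : R).

Hypothesis mass_plane : forall u c, u != 0 -> m [set x | dotv u x = c] = 0.
Hypothesis mass_open : forall U : set 'rV[R]_d, open U -> U !=set0 -> 0 < m U.

Lemma msb_plane u c : msb [set x | dotv u x = c].
Proof.
rewrite (_ : mkset _ = hs u c true `&` hs u c false).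
  by apply: measurableI; exact: msb_hs.
apply/seteqP; split => x /=; first by move=> ->.
by case=> h1 h2; apply/eqP; rewrite eq_le h2 h1.
Qed.

Lemma massT_gt0 : 0 < m setT.
Proof. by apply: mass_open; [exact: openT|exists 0]. Qed.

Lemma convex_interiorT : convex_interior mu setT.
Proof.
exists setT; split => //; first exact: openT.
by rewrite setDv mass0.
Qed.

Section cuts.
Variable l : nat.

Definition cut_level (j : 'I_l) : R := j.+1%:R / l.+1%:R.

Lemma cut_level_itv j : 0 < cut_level j < 1.
Proof.
rewrite divr_gt0 ?ltr0n//= ltr_pdivrMr ?ltr0n// mul1r ltr_nat ltnS.
exact: ltn_ord.
Qed.

Lemma cut_levelN j : cut_level (rev_ord j) = 1 - cut_level j.
Proof.
rewrite /cut_level /= subnSK// natrB ?[(j <= l)%N]ltnW//.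
by rewrite -[l.+1%:R]natr1 -[j.+1%:R]natr1; field; rewrite natr1 pnatr_eq0.
Qed.

Definition cut u (j : 'I_l) : R := quantile mu setT u (cut_level j).

Definition reg u (i : 'I_l.+1) : set 'rV[R]_d :=
  [set x | forall j : 'I_l, hs u (cut u j) (j < i)%N x].

Lemma cdf_cut u j : u != 0 -> m (hs u (cut u j) false) = cut_level j * m setT.
Proof.
move=> u0; have := quantileP mass_plane measurableT u0 massT_gt0 (cut_level_itv j).
by rewrite /cdf setTI.
Qed.

Lemma cut_lt u (i j : 'I_l) : u != 0 -> (i < j)%N -> cut u i < cut u j.
Proof.
move=> u0 ij; rewrite ltNge; apply/negP => ji.
have : m (hs u (cut u j) false) <= m (hs u (cut u i) false).
  apply: le_mass; [exact: msb_hs|exact: msb_hs|].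
  by move=> x /= h; exact: le_trans ji.
rewrite !cdf_cut// ler_pM2r ?massT_gt0// /cut_level ler_pM2r ?invr_gt0 ?ltr0n//.
by rewrite ler_nat ltnS leqNgt ij.
Qed.

Lemma cut_le u (i j : 'I_l) : u != 0 -> (i <= j)%N -> cut u i <= cut u j.
Proof.
move=> u0; rewrite leq_eqVlt => /predU1P[/val_inj -> //|ij].
exact/ltW/cut_lt.
Qed.

Lemma cutN u j : u != 0 -> cut (- u) j = - cut u (rev_ord j).
Proof.
move=> u0; rewrite /cut -[in LHS](rev_ordK j) cut_levelN.
apply: quantileN => //; [exact: convex_interiorT|exact: massT_gt0|exact: cut_level_itv].
Qed.

Lemma msb_reg u i : msb (reg u i).
Proof. by apply: msb_all => j; exact: msb_hs. Qed.

(** Reversing the direction lists the same cuts in reverse order and swaps the sides of each. *)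
Lemma regN u i : u != 0 -> reg (- u) i = reg u (rev_ord i).
Proof.
move=> u0; have lt_rev (j : 'I_l) : (rev_ord j < rev_ord i)%N = ~~ (j < i)%N.
  by rewrite /= subSS -leqNgt; have := ltn_ord j; have := ltn_ord i; lia.
apply/seteqP; split => x H j.
  by have := H (rev_ord j); rewrite cutN// hsN -lt_rev !rev_ordK.
by rewrite cutN// hsN -lt_rev; exact: H.
Qed.

(** Passing to open half-spaces loses only points on finitely many null hyperplanes. *)
Lemma reg_convex_interior u i : u != 0 -> convex_interior mu (reg u i).
Proof.
move=> u0; pose D := [set x | forall j : 'I_l, ohs u (cut u j) (j < i)%N x].
have Dopen : open D.
  rewrite openE => x Dx; apply: (@filter_forall _ _ _ (nbhs x) (nbhs_filter x)) => j.
  by have := @ohs_open _ _ u (cut u j) (j < i)%N; rewrite openE; apply.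
exists D; split => //.
- by move=> x y t Dx Dy t01 j; apply: segment_closed_ohs.
- by move=> x Dx j; have := Dx j; case: (j < i)%N; exact: ltW.
- apply/eqP; rewrite eq_le mass_ge0 andbT.
  have <- : \sum_(j < l) m [set x | dotv u x = cut u j] = 0.
    by apply: big1 => j _; exact: mass_plane.
  apply: mass_big_le => [|j|x [Hx /existsNP[j Hj]]].
  + by apply: measurableD; [exact: msb_reg|exact: euclid_open].
  + exact: msb_plane.
  + exists j; move: Hj; have := Hx j; rewrite /hs /ohs.
    by case: (j < i)%N => /= h /negP; rewrite -leNgt => h'; apply/eqP; rewrite eq_le h h'.
Qed.

(** For nonzero [u], the union of the regions up to number [i]. Written as constraints from cut [i]
    on, it also makes sense for [i = l], where it is the whole space. *)
Definition lower u (i : nat) : set 'rV[R]_d :=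
  [set x | forall j : 'I_l, (i <= j)%N -> hs u (cut u j) false x].

Lemma lowerE u (j : 'I_l) : u != 0 -> lower u j = hs u (cut u j) false.
Proof.
move=> u0; apply/seteqP; split => x /=; first exact.
by move=> h j' jj'; exact: le_trans h (cut_le u0 jj').
Qed.

Lemma lowerT u : lower u l = setT.
Proof. by apply/seteqP; split => // x _ j; rewrite leqNgt ltn_ord. Qed.

Lemma lower_mass u (i : 'I_l.+1) : u != 0 ->
  msb (lower u i) /\ m (lower u i) = i.+1%:R / l.+1%:R * m setT.
Proof.
move=> u0; have := ltn_ord i; rewrite ltnS leq_eqVlt => /predU1P[->|il].
  by rewrite lowerT divff ?mul1r ?pnatr_eq0.
have -> := lowerE (Ordinal il) u0.
by split; [exact: (@msb_hs _ _ u (cut u (Ordinal il)) false)|rewrite cdf_cut].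
Qed.

Lemma reg_mass u i : u != 0 -> m (reg u i) = m setT / l.+1%:R.
Proof.
move=> u0; have l0 : l.+1%:R != 0 :> R by rewrite pnatr_eq0.
case: (unliftP ord0 i) => [j ij|i0]; last first.
  have -> : reg u i = lower u i.
    by rewrite i0; apply/seteqP; split => x H j; have := H j; [move=> + _|apply].
  by have [_ ->] := lower_mass i u0; rewrite i0 mul1r mulrC.
(* Cut [j], the lower boundary of region [i = j + 1], splits [lower u i] into [lower u j] and
   [reg u i]. *)
have [mi mE] := lower_mass i u0.
have := mass_hs_split mass_plane (cut u j) mi u0.
have iE : i = j.+1 :> nat by rewrite ij /= /bump.
have -> : lower u i `&` hs u (cut u j) false = lower u j.
  rewrite lowerE//; apply/seteqP; split => x; first by case.
  move=> xj; split => // j' ij'; apply: (le_trans xj); apply: cut_le => //.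
  by move: ij'; rewrite iE => /ltnW.
have -> : lower u i `&` hs u (cut u j) true = reg u i.
  apply/seteqP; split => x.
    move=> [H xj] j'; case: ltnP => [j'i|]; last exact: H.
    by apply: le_trans xj; apply: cut_le => //; move: j'i; rewrite iE ltnS.
  move=> H; split; last by have := H j; rewrite iE ltnSn.
  by move=> j' ij'; have := H j'; rewrite ltnNge ij'.
have [_ mjE] := lower_mass (widen_ord (leqnSn l) j) u0; rewrite /= in mjE.
rewrite mE mjE iE => H; apply: (addrI (j.+1%:R / l.+1%:R * m setT)); rewrite -H.
by rewrite -[j.+2%:R]natr1; field.
Qed.

Lemma reg_cvg (T : Type) (F : set_system T) {FF : Filter F} (u : T -> 'rV[R]_d) u0 i :
  u0 != 0 -> (\forall p \near F, u p != 0) -> u p @[p --> F] --> u0 ->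
  sd mu (reg (u p) i) (reg u0 i) @[p --> F] --> (0 : R).
Proof.
move=> u0_neq0 uF_neq0 uF; apply: sd_cvg_all => [p j|j|j]; try exact: msb_hs.
apply: sd_cvg_hs => //; apply: quantile_cvg => //.
- exact: convex_interiorT.
- exact: massT_gt0.
- exact: cut_level_itv.
- by under eq_fun do rewrite sdxx; exact: cvg_cst.
Qed.

End cuts.

Variable k : nat.
Local Notation l := (2 * k)%N.
Implicit Types (x : 'M[R]_(3, d)) (i : 'I_l.+1) (s t : bool).

Definition middle : 'I_l.+1 := inord k.

Lemma rev_middle : rev_ord middle = middle.
Proof. by apply: val_inj; rewrite /= inordK; lia. Qed.

Definition bisector x (b : 'I_3) : R := quantile mu (reg (row 0 x) middle) (row b x) 2^-1.

Definition box_set x i s t : set 'rV[R]_d := reg (row 0 x) i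
  `&` hs (row 1 x) (bisector x 1) s `&` hs (row 2 x) (bisector x 2) t.

Definition box_mass x i s t : R := m (box_set x i s t).

Lemma row_neg_same (b : 'I_3) x : row b (neg_row b x) = - row b x.
Proof. by apply/rowP => j; rewrite !mxE eqxx. Qed.

Lemma row_neg_other (b c : 'I_3) x : c != b -> row c (neg_row b x) = row c x.
Proof. by move=> cb; apply/rowP => j; rewrite !mxE (negPf cb). Qed.

Let half_itv : 0 < (2^-1 : R) < 1.
Proof. by apply/andP; split; lra. Qed.

Lemma reg_middle_gt0 u : u != 0 -> 0 < m (reg u middle).
Proof. by move=> u0; rewrite reg_mass// divr_gt0// massT_gt0. Qed.

(** Negating the common normal exchanges opposite regions, and the middle one is its own
    opposite. *)
Lemma bisector_neg0 x (b : 'I_3) : nz_rows x -> b != 0 ->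
  bisector (neg_row 0 x) b = bisector x b.
Proof.
move=> x0 b0; rewrite /bisector row_neg_same row_neg_other// regN//.
by rewrite rev_middle.
Qed.

(** Level 1/2 is its own complement, so reversing the normal keeps the hyperplane. *)
Lemma bisector_neg x (b : 'I_3) : nz_rows x -> b != 0 ->
  bisector (neg_row b x) b = - bisector x b.
Proof.
move=> x0 b0; rewrite /bisector row_neg_same row_neg_other 1?eq_sym//.
have half : 1 - 2^-1 = 2^-1 :> R by lra.
rewrite -{1}half; apply: quantileN => //; [exact: msb_reg| |exact: reg_middle_gt0].
exact: reg_convex_interior.
Qed.

Lemma bisector_neg_other x (b c : 'I_3) : b != 0 -> c != b ->
  bisector (neg_row b x) c = bisector x c.
Proof.
by move=> b0 cb; rewrite /bisector (row_neg_other _ cb) (row_neg_other (b := b)) 1?eq_sym.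
Qed.

Lemma box_mass_neg0 x i s t : nz_rows x ->
  box_mass (neg_row 0 x) i s t = box_mass x (rev_ord i) s t.
Proof.
move=> x0; rewrite /box_mass /box_set (@bisector_neg0 x 1 x0 isT) (@bisector_neg0 x 2 x0 isT).
rewrite row_neg_same (@row_neg_other 0 1 x isT) (@row_neg_other 0 2 x isT).
by rewrite (regN i (x0 0)).
Qed.

Lemma box_mass_neg1 x i s t : nz_rows x ->
  box_mass (neg_row 1 x) i s t = box_mass x i (~~ s) t.
Proof.
move=> x0; rewrite /box_mass /box_set (@bisector_neg x 1 x0 isT).
rewrite (@bisector_neg_other x 1 2 isT isT) row_neg_same hsN.
by rewrite (@row_neg_other 1 0 x isT) (@row_neg_other 1 2 x isT).
Qed.

Lemma box_mass_neg2 x i s t : nz_rows x ->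
  box_mass (neg_row 2 x) i s t = box_mass x i s (~~ t).
Proof.
move=> x0; rewrite /box_mass /box_set (@bisector_neg x 2 x0 isT).
rewrite (@bisector_neg_other x 2 1 isT isT) row_neg_same hsN.
by rewrite (@row_neg_other 2 0 x isT) (@row_neg_other 2 1 x isT).
Qed.

Lemma msb_box_set x i s t : msb (box_set x i s t).
Proof.
by apply: measurableI; [apply: measurableI; [exact: msb_reg|exact: msb_hs]|exact: msb_hs].
Qed.

Lemma row_cvg (b : 'I_3) x : row b y @[y --> x] --> row b x.
Proof.
apply: (@cvg_mx _ _ _ _ (nbhs x) (nbhs_filter x)) => i j.
rewrite mxE; under eq_fun do rewrite mxE; exact: coord_continuous.
Qed.

Lemma box_mass_cvg x i s t : nz_rows x ->
  box_mass y i s t @[y --> x] --> box_mass x i s t.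
Proof.
move=> x0.
have near0 b : \forall y \near x, row b y != 0.
  exact: (@cvgr_neq0 _ _ _ (nbhs x) (nbhs_filter x) _ _ (@row_cvg b x)).
have regF i' : sd mu (reg (row 0 y) i') (reg (row 0 x) i') @[y --> x] --> (0 : R).
  apply: (@reg_cvg _ _ (nbhs x) (nbhs_filter x)) => //.
    exact: near0.
  exact: row_cvg.
have hsF (b : 'I_3) r : sd mu (hs (row b y) (bisector y b) r)
    (hs (row b x) (bisector x b) r) @[y --> x] --> (0 : R).
  apply: (@sd_cvg_hs _ _ _ _ (nbhs x) (nbhs_filter x)) => //; first exact: row_cvg.
  apply: (@quantile_cvg _ _ _ _ _ _ (nbhs x) (nbhs_filter x)) => //.
  - by move=> y; exact: msb_reg.
  - exact: msb_reg.
  - exact: reg_convex_interior.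
  - exact: reg_middle_gt0.
  - exact: near0.
  - exact: row_cvg.
apply: (@sd_cvg_mass _ _ _ _ (nbhs x) (nbhs_filter x)); try by move=> *; exact: msb_box_set.
apply: (@sd_cvgI _ _ _ _ (nbhs x) (nbhs_filter x)); try by move=> *; exact: msb_hs.
- by move=> y; apply: measurableI; [exact: msb_reg|exact: msb_hs].
- by apply: measurableI; [exact: msb_reg|exact: msb_hs].
- apply: (@sd_cvgI _ _ _ _ (nbhs x) (nbhs_filter x)) => //;
    by move=> *; try exact: msb_hs; exact: msb_reg.
- exact: hsF.
Qed.

Lemma mass_quarters A u v c e : msb A -> u != 0 -> v != 0 ->
  m A = (m (A `&` hs u c false `&` hs v e false) + m (A `&` hs u c false `&` hs v e true)) +
        (m (A `&` hs u c true `&` hs v e false) + m (A `&` hs u c true `&` hs v e true)).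
Proof.
move=> mA u0 v0; rewrite (mass_hs_split mass_plane c mA u0); congr (_ + _).
  exact: (mass_hs_split mass_plane e (msbI_hs u c false mA) v0).
exact: (mass_hs_split mass_plane e (msbI_hs u c true mA) v0).
Qed.

Lemma box_mass_sum x i : nz_rows x ->
  (box_mass x i false false + box_mass x i false true) +
  (box_mass x i true false + box_mass x i true true) = m setT / l.+1%:R.
Proof.
move=> x0; rewrite -(reg_mass i (x0 0)).
by rewrite (mass_quarters (bisector x 1) (bisector x 2) (msb_reg (row 0 x) i) (x0 1) (x0 2)).
Qed.

(** Both further hyperplanes bisect the middle region by construction. Two of its three balance
    conditions are thus automatic, which leaves one component of [test] for it. *)
Lemma box_mass_middle x : nz_rows x ->
  box_mass x middle true false + box_mass x middle true true =
    box_mass x middle false false + box_mass x middle false true /\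
  box_mass x middle false true + box_mass x middle true true =
    box_mass x middle false false + box_mass x middle true false.
Proof.
move=> x0; set A := reg (row 0 x) middle.
have mr : msb A by exact: msb_reg.
have halves (b : 'I_3) : m (A `&` hs (row b x) (bisector x b) true) =
    m (A `&` hs (row b x) (bisector x b) false).
  have h1 := mass_hs_split mass_plane (bisector x b) mr (x0 b).
  have h2 := quantileP mass_plane mr (x0 b) (reg_middle_gt0 (x0 0)) half_itv.
  rewrite -/(bisector x b) /cdf h1 in h2; lra.
split.
  rewrite /box_mass /box_set -!(mass_hs_split mass_plane (bisector x 2) (msbI_hs _ _ _ mr) (x0 2)).
  exact: halves.
have swap s t : box_mass x middle s t =
    m (A `&` hs (row 2 x) (bisector x 2) t `&` hs (row 1 x) (bisector x 1) s).
  by rewrite /box_mass /box_set setIAC.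
rewrite !swap -!(mass_hs_split mass_plane (bisector x 1) (msbI_hs _ _ _ mr) (x0 1)).
exact: halves.
Qed.

End boxes.

(** * The Dickson polynomial *)

Lemma F2x3_addpp (p : F2x3) : p + p = 0.
Proof. by apply/mpoly.mpolyP => n; rewrite mpoly.mcoeff0 mpoly.mcoeffD; exact: addFF. Qed.

Lemma det_mx33 (A : comNzRingType) (M : 'M[A]_3) :
  \det M = M 0 0 * (M 1 1 * M 2 2 - M 1 2 * M 2 1) -
           M 0 1 * (M 1 0 * M 2 2 - M 1 2 * M 2 0) +
           M 0 2 * (M 1 0 * M 2 1 - M 1 1 * M 2 0).
Proof.
rewrite (expand_det_row _ 0) !big_ord_recl big_ord0 addr0 /cofactor.
rewrite !(expand_det_row _ 0) !big_ord_recl !big_ord0 !addr0 /cofactor !det_mx11 !mxE /=.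
pose N (a b : nat) := M (inord a) (inord b).
have E (i j : 'I_3) : M i j = N i j by rewrite /N !inord_val.
by rewrite !E /= /bump /=; ring.
Qed.

(** The Moore determinant is the product of the seven nonzero linear forms over ['F_2]. *)
Lemma moore3 (A : comNzRingType) (x y z : A) : (forall p : A, p + p = 0) ->
  x * (y ^+ 2 * z ^+ 4 - y ^+ 4 * z ^+ 2) - x ^+ 2 * (y * z ^+ 4 - y ^+ 4 * z) +
  x ^+ 4 * (y * z ^+ 2 - y ^+ 2 * z) =
  y * z * (x + y) * (x + z) * (y + z) * (x + y + z) * x.
Proof.
move=> char2; set Q := RHS.
(* [Z] is half the difference of the two sides over the integers; adding it twice gives an identity
   valid in every commutative ring. *)
pose Z := - (x*y^+3*z^+3 + x*y^+4*z^+2 + x^+2*y*z^+4 + 2%:R*x^+2*y^+2*z^+3 +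
  2%:R*x^+2*y^+3*z^+2 + x^+3*y*z^+3 + 2%:R*x^+3*y^+2*z^+2 + x^+3*y^+3*z + x^+4*y^+2*z).
by rewrite -[RHS]addr0 -(char2 Z) /Q /Z; ring.
Qed.

Lemma dickson3_quotE : dickson3_quot =
  xvar 1 * xvar 2 * (xvar 0 + xvar 1) * (xvar 0 + xvar 2) * (xvar 1 + xvar 2) *
  (xvar 0 + xvar 1 + xvar 2).
Proof.
have x0 : xvar 0 != 0.
  apply/eqP => /(congr1 (mpoly.mcoeff (mpoly.mnm1 0))).
  by rewrite mpoly.mcoeffXU mpoly.mcoeff0.
apply: (mulIf x0); rewrite dickson3_quotP /dickson3 det_mx33 !mxE /=.
by rewrite -(moore3 _ _ _ F2x3_addpp).
Qed.

(** * The test map *)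

(* The characters of the components of [test]: six for each pair of opposite
   regions, and one for the middle region. *)
Definition test_char (j : nat) (b : 'I_3) : 'F_2 :=
  (if b == 0 then odd j else
   if b == 1 then ((j %% 6)./2 != 2)%N else ((j %% 6)./2 != 1)%N)%:R.

Lemma sum_ord3 (V : nmodType) (G : 'I_3 -> V) : \sum_b G b = G 0 + G 1 + G 2.
Proof.
rewrite !big_ord_recl big_ord0 addr0 addrA.
by congr (_ + _ + _); congr G; apply: val_inj.
Qed.

Lemma linear_form3 (c : 'I_3 -> bool) : linear_form (fun b => (c b)%:R) =
  (if c 0 then xvar 0 else 0) + (if c 1 then xvar 1 else 0) + (if c 2 then xvar 2 else 0)
  :> F2x3.
Proof.
have E b : (c b)%:R *: mpoly.mpolyX 'F_2 (mpoly.mnm1 b) = if c b then xvar b else 0.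
  by case: (c b); rewrite ?scale1r ?scale0r.
by rewrite /linear_form sum_ord3 !E.
Qed.

(** Each run of six characters gives the six linear factors of [dickson3_quot]; the last index
    [6 * k] contributes [xvar 1 + xvar 2]. *)
Lemma prod_test_char k : \prod_(j < 6 * k + 1) (linear_form (test_char j) : F2x3) =
  (xvar 1 + xvar 2) * dickson3_quot ^+ k.
Proof.
have charE j (c0 c1 c2 : bool) : odd j = c0 -> ((j %% 6)./2 != 2)%N = c1 ->
    ((j %% 6)./2 != 1)%N = c2 -> linear_form (test_char j) =
    (if c0 then xvar 0 else 0) + (if c1 then xvar 1 else 0) + (if c2 then xvar 2 else 0)
    :> F2x3.
  by move=> <- <- <-; rewrite /test_char linear_form3.
rewrite addn1 big_ord_recr /= mulrC; congr (_ * _).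
  rewrite (@charE _ false true true) ?add0r ?oddM// mulnC modnMl //.
elim: k => [|k IH]; first by rewrite muln0 big_ord0 expr0.
rewrite (_ : 6 * k.+1 = (6 * k).+2.+4)%N; last lia.
do 6 rewrite big_ord_recr /=; rewrite IH exprSr.
have md r : ((r + 6 * k) %% 6 = r %% 6)%N by rewrite addnC mulnC modnMDl.
have od r : odd (r + 6 * k) = odd r by rewrite oddD oddM addbF.
rewrite (@charE (0 + 6 * k)%N false true true) ?md ?od//.
rewrite (@charE (1 + 6 * k)%N true true true) ?md ?od//.
rewrite (@charE (2 + 6 * k)%N false true false) ?md ?od//.
rewrite (@charE (3 + 6 * k)%N true true false) ?md ?od//.
rewrite (@charE (4 + 6 * k)%N false false true) ?md ?od//.
rewrite (@charE (5 + 6 * k)%N true false true) ?md ?od//.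
by rewrite dickson3_quotE; ring.
Qed.

Section test_map.
Variables (R : realType) (d : nat) (mu : {finite_measure set (euclid R d) -> \bar R}).
Local Notation m := (fmass mu).

Hypothesis mass_plane : forall (u : 'rV[R]_d) c, u != 0 -> m [set x | dotv u x = c] = 0.
Hypothesis mass_open : forall U : set 'rV[R]_d, open U -> U !=set0 -> 0 < m U.

Variable k : nat.
Local Notation l := (2 * k)%N.
Implicit Types (x : 'M[R]_(3, d)) (i : 'I_l.+1).

(** The three nontrivial characters of (Z/2)^2 on the four boxes of region [i]: the product of the
    two sides, then each side alone. *)
Definition signed_mass (ka : nat) x i : R :=
  let b := box_mass mu x i in
  match ka with
  | 0%N => b true true + b false false - (b true false + b false true)
  | 1%N => b true true + b true false - (b false true + b false false)
  | _ => b true true + b false true - (b true false + b false false)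
  end.

(** The index encodes [j = 6 * i + 2 * ka + parity]. Sum and difference are the even and odd parts
    under the exchange of opposite regions. *)
Definition test j x : R :=
  let i := inord (j %/ 6) in let ka := (j %% 6)./2 in
  if odd j then signed_mass ka x i - signed_mass ka x (rev_ord i)
  else signed_mass ka x i + signed_mass ka x (rev_ord i).

Lemma test_neg j b x : nz_rows x ->
  test j (neg_row b x) = if test_char j b == 0 then test j x else - test j x.
Proof.
move=> x0; rewrite /test /test_char.
have F2b (c : bool) : (c%:R == 0 :> 'F_2) = ~~ c by case: c.
rewrite F2b; set i := inord _.
have ka3 : ((j %% 6)./2 < 3)%N by have := ltn_pmod j (isT : (0 < 6)%N); lia.
case: b => [[|[|[|//]]] b3]; rewrite /=.
- rewrite (_ : Ordinal b3 = 0); last exact: val_inj.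
  have E ka i' : signed_mass ka (neg_row 0 x) i' = signed_mass ka x (rev_ord i').
    by rewrite /signed_mass !box_mass_neg0.
  by rewrite !E rev_ordK; case: (odd j) => /=; rewrite ?opprB// addrC.
- rewrite (_ : Ordinal b3 = 1); last exact: val_inj.
  have E ka i' : (ka < 3)%N -> signed_mass ka (neg_row 1 x) i' =
      if (ka != 2)%N then - signed_mass ka x i' else signed_mass ka x i'.
    by case: ka => [|[|[|//]]] _; rewrite /signed_mass !box_mass_neg1//=; ring.
  by rewrite !E//; case: (_ != _ :> nat); case: (odd j) => /=; ring.
- rewrite (_ : Ordinal b3 = 2); last exact: val_inj.
  have E ka i' : (ka < 3)%N -> signed_mass ka (neg_row 2 x) i' =
      if (ka != 1)%N then - signed_mass ka x i' else signed_mass ka x i'.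
    by case: ka => [|[|[|//]]] _; rewrite /signed_mass !box_mass_neg2//=; ring.
  by rewrite !E//; case: (_ != _ :> nat); case: (odd j) => /=; ring.
Qed.

Lemma test_cvg j x : nz_rows x -> test j y @[y --> x] --> test j x.
Proof.
move=> x0; have E ka i : signed_mass ka y i @[y --> x] --> signed_mass ka x i.
  by case: ka => [|[|ka]]; apply: (@cvgB _ _ _ (nbhs x) (nbhs_filter x));
    apply: (@cvgD _ _ _ (nbhs x) (nbhs_filter x)); exact: box_mass_cvg.
rewrite /test; case: (odd j).
  by apply: (@cvgB _ _ _ (nbhs x) (nbhs_filter x)); exact: E.
by apply: (@cvgD _ _ _ (nbhs x) (nbhs_filter x)); exact: E.
Qed.

Lemma signed_mass_middle x ka : nz_rows x -> (0 < ka < 3)%N ->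
  signed_mass ka x (middle k) = 0.
Proof.
move=> x0; have [h1 h2] := box_mass_middle mass_plane mass_open k x0.
by case: ka => [|[|[|//]]] _ //; rewrite /signed_mass /=; lra.
Qed.

(** Vanishing sum and difference make both signed masses vanish. Once all three characters are zero
    and the mass of the region is known, the four boxes are equal. *)
Lemma test_eq0 x : nz_rows x -> (forall j, (j < 6 * k + 1)%N -> test j x = 0) ->
  forall i s t, box_mass mu x i s t = m setT / l.+1%:R / 4%:R.
Proof.
move=> x0 tx0.
have low (ka i : nat) : (ka < 3)%N -> (i < k)%N ->
    signed_mass ka x (inord i) = 0 /\ signed_mass ka x (rev_ord (inord i)) = 0.
  move=> ka3 ik; have := tx0 (6 * i + ka.*2)%N; have := tx0 (6 * i + ka.*2.+1)%N.
  rewrite /test.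
  have -> : ((6 * i + ka.*2) %/ 6 = i)%N by lia.
  have -> : ((6 * i + ka.*2.+1) %/ 6 = i)%N by lia.
  have -> : (((6 * i + ka.*2) %% 6)./2 = ka)%N by lia.
  have -> : (((6 * i + ka.*2.+1) %% 6)./2 = ka)%N by lia.
  have -> : odd (6 * i + ka.*2) = false by lia.
  have -> : odd (6 * i + ka.*2.+1) = true by lia.
  move=> h1 h2.
  have {}h1 := h1 ltac:(lia); have {}h2 := h2 ltac:(lia).
  by split; lra.
have all0 ka i : (ka < 3)%N -> signed_mass ka x i = 0.
  move=> ka3; case: (ltngtP i k) => [ik|ik|ik].
  - by have [+ _] := low ka i ka3 ik; rewrite inord_val.
  - have rk : (rev_ord i < k)%N by rewrite /= subSS; have := ltn_ord i; lia.
    by have [_] := low ka _ ka3 rk; rewrite inord_val rev_ordK.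
  - have -> : i = middle k by apply: val_inj; rewrite /= inordK; lia.
    case: ka ka3 => [_|ka ka3]; last exact: signed_mass_middle.
    (* The middle region is its own opposite, so this component is twice its signed mass. *)
    have := tx0 (6 * k)%N; rewrite /test oddM mulKn// modnMr /=.
    by rewrite -/(middle k) rev_middle => /(_ ltac:(lia)); lra.
move=> i; have := box_mass_sum mass_plane mass_open i x0.
have := all0 0%N i isT; have := all0 1%N i isT; have := all0 2%N i isT.
rewrite /signed_mass /=; move: (m setT / _) => T h1 h2 h3 h4.
by do 2 case; lra.
Qed.

End test_map.

(** The sides can be chosen to face away from each other. In the theorem this would put a box of
    positive mass inside a hyperplane. *)
Lemma parallel_halfspaces (R : realType) d (u : 'rV[R]_d) (a b c : R) : c != 0 ->
  exists s t, hs u a s `&` hs (c *: u) b t `<=` [set x | dotv u x = a].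
Proof.
move=> c0.
(* Dividing by [c] exchanges the sides when [c] is negative. *)
have sgn (t : bool) x : hs (c *: u) b (t == (0 < c)) x -> hs u (b / c) t x.
  rewrite /hs; case: (ltgtP 0 c) c0 => //= cc _; case: t => /=; rewrite dotvZl.
  - by rewrite ler_pdivrMr// mulrC.
  - by rewrite ler_pdivlMr// mulrC.
  - by rewrite ler_ndivrMr// mulrC.
  - by rewrite ler_ndivlMr// mulrC.
have [ab|ba] := leP a (b / c).
  exists false, (true == (0 < c)) => x [/= xa /sgn/= bx].
  by apply/eqP; rewrite eq_le xa (le_trans ab bx).
exists true, (false == (0 < c)) => x [/= ax /sgn/= xb].
by apply/eqP; rewrite eq_le ax andbT (le_trans xb (ltW ba)).
Qed.

(** * Mass distributions and the conclusion *)

Section mass_distribution.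
Variables (R : realType) (d : nat) (mu : {finite_measure set (euclid R d) -> \bar R}).
Hypothesis mu_mass : mass_distribution mu.

Lemma mass_distribution_plane (u : 'rV[R]_d) c : u != 0 -> fmass mu [set x | dotv u x = c] = 0.
Proof.
move=> u0; case: mu_mass => -[f /integrableP[mf _] muE] _.
rewrite /fmass muE; last exact: msb_plane.
rewrite null_set_integral//.
- exact: msb_plane.
- exact: measurable_funS mf.
- exact: lebesgue_euclid_hyperplane.
Qed.

Lemma mass_distribution_open (U : set 'rV[R]_d) : open U -> U !=set0 -> 0 < fmass mu U.
Proof.
move=> Uo U0; case: mu_mass => _ /(_ U Uo U0).
by rewrite massE ?lte_fin//; exact: euclid_open.
Qed.

End mass_distribution.

Theorem theorem4p1 (R : realType) (d k : nat) (d_ge1 : (1 <= d)%N)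
    (notin : ~ in_ideal (fun i : 'I_3 => xvar i ^+ d)
                        ((xvar 1 + xvar 2) * dickson3_quot ^+ k))
    (mu : {finite_measure set (euclid R d) -> \bar R})
    (mass : mass_distribution mu) :
  exists (P : parallel_hyperplanes R d (2 * k)) (H K : hyperplane R d),
    non_parallel P H K /\ equipartition mu P H K.
Proof.
have plane := mass_distribution_plane mass.
have openm := mass_distribution_open mass.
rewrite -prod_test_char in notin.
have [a ad coef] := not_in_ideal notin.
have [x x0 tx] := borsuk_ulam_spheres (fun j b x => @test_neg _ _ _ plane openm k j b x)
  (fun j x => @test_cvg _ _ _ plane openm k j x) d_ge1 ad coef.
have boxE := test_eq0 plane openm x0 tx.
pose P := ParallelHyperplanes (x0 0) (fun i j => @cut_lt _ _ _ plane openm (2 * k) _ i j (x0 0)).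
pose H := Hyperplane (bisector mu k x 1) (x0 1).
pose K := Hyperplane (bisector mu k x 2) (x0 2).
have box_setE i s t : box P H K i s t = box_set mu x i s t.
  rewrite /box /box_set; congr (_ `&` _ `&` _); apply/seteqP.
  by split => y Hy j; have := Hy j; rewrite /= /hs; case: (j < i)%N.
(* Every box has positive mass, so none lies in a null hyperplane. *)
have thick (i : 'I_(2 * k).+1) s t (u : 'rV[R]_d) c : u != 0 ->
    ~ box_set mu x i s t `<=` [set y | dotv u y = c].
  move=> u0 sub; have := boxE i s t; rewrite /box_mass.
  rewrite (mass_null (msb_box_set mu x i s t) (msb_plane u c) sub (plane u c u0)).
  by apply/eqP; rewrite lt_eqF// !divr_gt0// massT_gt0.
have scale_neq0 u v c : v = c *: u -> v != 0 :> 'rV[R]_d -> c != 0.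
  by move=> -> ; apply: contra_neq => ->; rewrite scale0r.
have not_parallel (j : 'I_(2 * k)) (b : 'I_3) c : b != 0 -> row b x = c *: row 0 x -> False.
  move=> b0 vc; have c0 := scale_neq0 _ _ _ vc (x0 b).
  have [s [t sub]] := parallel_halfspaces (row 0 x) (cut mu (row 0 x) j) (bisector mu k x b) c0.
  (* The last region is above every cut and the first one below, so this region lies on side [s] of
     cut [j]. *)
  pose i : 'I_(2 * k).+1 := if s then ord_max else ord0.
  have ji : (j < i)%N = s by rewrite /i; case: (s) => //=; rewrite ltn_ord.
  have [b1|b2] : b = 1 \/ b = 2.
    by case: b b0 {vc sub} => [[|[|[|//]]] b3] // _; [left|right]; apply: val_inj.
  - apply: (@thick i t true _ (cut mu (row 0 x) j) (x0 0)) => y [[yi yt] _].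
    by apply: sub; rewrite -vc b1; split => //; have := yi j; rewrite ji.
  - apply: (@thick i true t _ (cut mu (row 0 x) j) (x0 0)) => y [[yi _] yt].
    by apply: sub; rewrite -vc b2; split => //; have := yi j; rewrite ji.
exists P, H, K; split; last first.
  move=> i s t; rewrite box_setE (massE mu (msb_box_set mu x i s t)) (massE mu measurableT).
  rewrite -EFinM; congr EFin; rewrite -[LHS]/(box_mass mu x i s t) boxE natrM invfM.
  by rewrite -mulrA mulrC [_^-1 * _]mulrC.
split; [by move=> j [c vc]; exact: (not_parallel j 1 c) | |].
  by move=> j [c vc]; exact: (not_parallel j 2 c).
move=> [c /= vc]; have c0 := scale_neq0 _ _ _ vc (x0 2).
have [s [t sub]] := parallel_halfspaces (row 1 x) (bisector mu k x 1) (bisector mu k x 2) c0.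
apply: (@thick ord0 s t _ (bisector mu k x 1) (x0 1)) => y [[_ ys] yt]; apply: sub.
by split => //; rewrite -vc.
Qed.
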